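(* Let $F(x,y,z)$ define a parabolic affine rotation surface $S$ with axis $\mathcal{A}$ and normal direction $L_{\mathcal{A}}$, and let $F_N(x,y,z)$ be the form of highest degree of $F(x,y,z)$. Then: (1) $F_N$ factors completely into (the linear form of) a single real plane $\Pi$ and several quadrics that can be either real or imaginary, possibly with multiplicity in both cases. The real plane and the quadrics may or may not be present in the factorization. (2) The real quadrics are elliptic or circular cones, with vertex at the origin. The elliptic cones have one axis of symmetry normal to both $\mathcal{A}$ and $L_{\mathcal{A}}$. The axis of revolution of the circular cones forms an angle of $\frac{\pi}{4}$ with $\mathcal{A}$. (3) For the non-real quadrics, if any, the associated matrix has one real eigenvalue, whose associated eigenvector is normal to both $\mathcal{A}$ and $L_{\mathcal{A}}$. (4) If the plane $\Pi$ is present, the direction of the normal vector to $\Pi$ is normal to $\mathcal{A}$. The planes parallel to $\Pi$ provide the family of parallel curves of $F(x,y,z)=0$, which are parabolas whose axes of symmetry are parallel to $\mathcal{A}$.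
   Context: Standing assumptions: $S$ is the zero set in $\mathbb{R}^3$ of an irreducible polynomial $F(x,y,z)$ with real coefficients, the real part of $S$ is 2-dimensional, and the Gaussian curvature of $S$ is not identically zero (in particular $S$ is not a plane). Write $F=F_N+F_{N-1}+\dots+F_0$ with $F_i$ homogeneous of degree $i$ and $N=\deg F$. $S$ is a parabolic affine rotation surface about a line $\mathcal{A}$ (the axis) if there is a rigid motion $T$ of $\mathbb{R}^3$ carrying $\mathcal{A}$ to the $z$-axis such that $T(S)$ is invariant, for all $\alpha\in\mathbb{R}$, under the matrices $\begin{pmatrix}1&0&0\\ \alpha&1&0\\ \alpha^2/2&\alpha&1\end{pmatrix}$. The normal direction $L_{\mathcal{A}}$ is the direction carried by (the linear part of) $T$ to the direction of the $x$-axis. The parallel curves of $S$ are the orbits of points of $S$ under this group (conjugated back by $T$), for generic points; each lies in a plane normal to $L_{\mathcal{A}}$. Factorization of $F_N$ is over $\mathbb{C}$, with factors considered up to nonzero constant multiples (factors may be rescaled by a suitable nonzero constant). A quadric factor is real if it is, up to a nonzero constant, a quadratic form with real coefficients, and non-real (imaginary) otherwise. The matrix associated with a quadratic form $q$ is the symmetric matrix $A$ with $q(\boldsymbol{x})=\boldsymbol{x}^TA\boldsymbol{x}$. *)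

(* Defs.v *)
From mathcomp Require Import all_boot all_order all_algebra.
From mathcomp Require Import classical_sets reals topology normedtype trigo.
From mathcomp Require Import complex.
(* The notations of mpoly clash with those of mathcomp-analysis. *)
From mathcomp Require Import -(notations) mpoly.

Set Implicit Arguments.
Unset Strict Implicit.
Unset Printing Implicit Defensive.
Import Order.TTheory GRing.Theory Num.Theory.
Import numFieldNormedType.Exports.

Local Open Scope classical_set_scope.
Local Open Scope ring_scope.

Notation pol3 K := (mpoly 3 K).

Section Polynomials.
Variable K : fieldType.
Implicit Types (F G q : pol3 K) (p l : 'cV[K]_3).

Definition ev F p : K := meval (fun i => p i 0) F.

Definition mdivides G F : Prop := exists H, F = G * H.

Definition irreducible_pol F : Prop :=
  [/\ F != 0, F \isn't a GRing.unit &
      forall G H, F = G * H -> G \is a GRing.unit \/ H \is a GRing.unit].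

(* mmeasure mdeg F is the total degree plus one. *)
Definition top_form F : pol3 K :=
  pihomog mdeg (mmeasure mdeg F).-1 F.

(* l is the normal vector of the plane linear_form l = 0 *)
Definition linear_form l : pol3 K :=
  \sum_(i < 3) l i 0 *: mpolyX K (mnm1 i).

Definition quadric q : Prop :=
  q \is ishomog1 2 mdeg /\ irreducible_pol q.

Definition form_matrix q (A : 'M[K]_3) : Prop :=
  A^T = A /\ forall p, ev q p = (p^T *m A *m p) 0 0.

End Polynomials.

Section RealSpace.
Variable R : realType.
Local Notation point := ('cV[R]_3).
Implicit Types (F q : pol3 R) (S C : set point) (p u v w : point).

(* The norm of mathcomp-analysis on matrices is the supremum norm, so the
   Euclidean structure is spelled out. *)
Definition dot u v : R := (u^T *m v) 0 0.
Definition enorm u : R := Num.sqrt (dot u u).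

Definition line_angle u v : R := acos (`|dot u v| / (enorm u * enorm v)).

Definition parallel u v : Prop := exists2 t : R, t != 0 & u = t *: v.

Record line := Line {
  line_point : point;
  line_dir : point;
  line_dir_neq0 : line_dir != 0 }.

Definition on_line (A : line) : set point :=
  [set p | exists t : R, p = line_point A + t *: line_dir A].

Definition zeros F : set point := [set p | ev F p = 0].

(* Dimension of a semialgebraic set: the largest d such that the projection
   onto some d of the coordinates has nonempty interior. *)
Definition fat_projection S (d : nat) : Prop :=
  exists2 f : 'I_d -> 'I_3, injective f &
    (interior [set \col_k p (f k) 0 | p in S] : set 'cV[R]_d) !=set0.

Definition has_dim S (d : nat) : Prop :=
  fat_projection S d /\ forall e, fat_projection S e -> (e <= d)%N.

Definition gradient F p : point := \col_i ev (mderiv i F) p.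

Definition hessian F p : 'M[R]_3 :=
  \matrix_(i, j) ev (mderiv j (mderiv i F)) p.

(* Gaussian curvature of the implicit surface F = 0 at a regular point:
   grad F^T adj(Hess F) grad F / |grad F|^4. *)
Definition gaussian_curvature F p : R :=
  ((gradient F p)^T *m \adj (hessian F p) *m gradient F p) 0 0
    / enorm (gradient F p) ^+ 4.

Definition curvature_not_identically_zero F : Prop :=
  exists p, [/\ zeros F p, gradient F p != 0 & gaussian_curvature F p != 0].

Record rigid_motion := RigidMotion {
  rot : 'M[R]_3;
  trans : point;
  rot_orthogonal : rot^T *m rot = 1%:M }.

Definition move (T : rigid_motion) p : point := rot T *m p + trans T.

Definition z_axis : set point := [set p | p 0 0 = 0 /\ p 1 0 = 0].

Definition par_mx (a : R) : 'M[R]_3 :=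
  \matrix_(i < 3, j < 3)
    nth 0 (nth [::] [:: [:: 1;            0; 0];
                        [:: a;            1; 0];
                        [:: a ^+ 2 / 2%:R; a; 1]] i) j.

Definition par_rotation_surface S (A : line) (T : rigid_motion) : Prop :=
  move T @` on_line A = z_axis /\
  forall a : R, [set par_mx a *m p | p in move T @` S] = move T @` S.

(* The direction sent to that of the x-axis by the linear part of T. *)
Definition normal_dir (T : rigid_motion) : point :=
  invmx (rot T) *m delta_mx 0 0.

Definition parallel_curve (T : rigid_motion) p : set point :=
  [set r | exists a : R, move T r = par_mx a *m move T p].

(* P holds on the complement in S of a proper algebraic subset of S. *)
Definition generically S (P : point -> Prop) : Prop :=
  exists2 G : pol3 R, ~ (S `<=` zeros G) &
    forall p, S p -> ev G p != 0 -> P p.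

(* A parabola whose axis of symmetry has direction w. *)
Definition parabola C w : Prop :=
  exists o u v (c : R),
    [/\ [/\ dot u u = 1, dot v v = 1 & dot u v = 0], parallel v w, c != 0 &
        C = [set p | exists t : R, p = o + t *: u + (c * t ^+ 2) *: v]].

Definition orthonormal e1 e2 e3 : Prop :=
  [/\ dot e1 e1 = 1, dot e2 e2 = 1 & dot e3 e3 = 1] /\
  [/\ dot e1 e2 = 0, dot e1 e3 = 0 & dot e2 e3 = 0].

Definition cone_eq e1 e2 e3 (a b : R) : set point :=
  [set p | (dot e1 p / a) ^+ 2 + (dot e2 p / b) ^+ 2 = dot e3 p ^+ 2].

Definition elliptic_cone C : Prop :=
  exists e1 e2 e3 (a b : R),
    [/\ orthonormal e1 e2 e3, 0 < a, 0 < b, a != b & C = cone_eq e1 e2 e3 a b].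

(* w spans the axis of revolution. *)
Definition circular_cone C w : Prop :=
  exists e1 e2 e3 (a : R),
    [/\ orthonormal e1 e2 e3, 0 < a, C = cone_eq e1 e2 e3 a a & parallel w e3].

Definition half_turn w p : point := (2%:R * dot w p / dot w w) *: w - p.

(* The line through the origin with direction w is an axis of symmetry. *)
Definition symmetry_axis C w : Prop := w != 0 /\ [set half_turn w p | p in C] = C.

Definition complexify F : pol3 R[i] := map_mpoly (real_complex R) F.

Definition cvec u : 'cV[R[i]]_3 := map_mx (real_complex R) u.

Definition real_up_to_constant (q : pol3 R[i]) : Prop :=
  exists q0 (c : R[i]), c != 0 /\ q = c *: complexify q0.

End RealSpace.

(* Main.v *)
Require Import Defs.
From mathcomp Require Import all_boot all_order all_algebra.
From mathcomp Require Import classical_sets reals topology normedtype trigo.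
From mathcomp Require Import complex.
From mathcomp Require Import -(notations) mpoly.
From mathcomp Require Import fingroup perm boolp ring lra zify.

Set Implicit Arguments.
Unset Strict Implicit.
Unset Printing Implicit Defensive.
Import Order.TTheory GRing.Theory Num.Theory.
Import numFieldNormedType.Exports.

Local Open Scope classical_set_scope.
Local Open Scope ring_scope.

(** In coordinates adapted to the axis, given by the rigid motion [T], the
    group fixes the functions [x] and [y^2 - 2 x z]. The theorem holds
    because the form of highest degree [FN] is invariant too, hence a
    polynomial in these two functions.

    Invariance of the zero set is first turned into invariance of [F]. As
    [F] is irreducible and its zero set has dimension two, [F] divides every
    polynomial that vanishes on its zeros ([vanishing_divides]); this rests
    on Gauss's lemma ([irreducible_Bezout]), which yields a relation between
    two coprime polynomials in which one variable has been eliminated. So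
    [F] divides its transforms under the group, the multiplier is a constant
    depending polynomially on the parameter, and it equals one
    ([par_act_invariant]). Looking at infinity, [FN] is invariant under the
    linear part of the group ([top_form_invariant]).

    An invariant form of degree [N] equals [x^N P((y^2 - 2 x z) / x^2)] for
    one polynomial [P] in one variable. Splitting [P] over the complex
    numbers gives a power of [x] times factors [y^2 - 2 x z - l x^2]
    ([invariant_form_factors]), which are irreducible ([cone_form_quadric]).
    Conversely, along a general parabola [x = 1], [y^2 - 2 x z = s] the form
    [FN] is a nonzero constant, so its divisors are constant there; hence
    the only quadrics dividing [FN] are multiples of some [y^2 - 2 x z - l
    x^2], and the only linear forms are multiples of [x] ([quadric_divisor],
    [linear_divisor]).

    The rest is read off the symmetric matrix of [y^2 - 2 x z - l x^2]. It
    has the eigenvalue [1] with eigenvector along the [y]-axis, which is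
    normal to the axis (the [z]-axis) and to the normal direction (the
    [x]-axis), and two others that are roots of [t^2 + l t - 1]. For real
    [l] these are real of opposite signs, so the zero set is a cone,
    circular exactly when [l = 0], with axis [(1, 0, 1)]; for non-real [l]
    they are not real. Finally, an orbit with [x != 0] is a parabola [y^2 -
    2 x z = s] in a plane parallel to [x = 0], and such a plane, with
    finitely many exceptions, meets the surface in finitely many of them
    ([plane_sections]). *)

(** * Unique factorization in polynomial rings *)

Section Divisibility.
Variable R : idomainType.
Implicit Types a b c p : R.

Definition divides a b : Prop := exists c, b = a * c.

Definition irreducible_elt a : Prop :=
  [/\ a != 0, a \isn't a GRing.unit &
      forall b c, a = b * c -> b \is a GRing.unit \/ c \is a GRing.unit].

Definition prime_elt a : Prop :=
  forall b c, divides a (b * c) -> divides a b \/ divides a c.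

(** Unique factorization, in the form used by inductions: [d] plays the role
    of the number of prime factors, so that chains of proper divisors stop. *)
Definition factorial_domain : Prop :=
  exists d : R -> nat,
    [/\ forall a b, a * b != 0 -> (d a <= d (a * b)%R)%N,
        forall a b, a * b != 0 -> b \isn't a GRing.unit ->
          (d a < d (a * b)%R)%N &
        forall a, irreducible_elt a -> prime_elt a].

Lemma divides_mulr a b c : divides a b -> divides a (b * c).
Proof. by case=> x ->; exists (x * c); rewrite mulrA. Qed.

Lemma divides_mull a b c : divides a b -> divides a (c * b).
Proof. by rewrite mulrC; apply: divides_mulr. Qed.

Lemma dividesD a b c : divides a b -> divides a c -> divides a (b + c).
Proof. by move=> [x ->] [y ->]; exists (x + y); rewrite mulrDr. Qed.

Lemma dividesN a b : divides a b -> divides a (- b).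
Proof. by move=> [x ->]; exists (- x); rewrite mulrN. Qed.

Lemma irreducible_factor a :
  factorial_domain -> a != 0 -> a \isn't a GRing.unit ->
  exists2 p, irreducible_elt p & divides p a.
Proof.
move=> [d [_ dlt _]]; have [n] := ubnP (d a).
elim: n a => // n IHn a /ltnSE dan a0 aU.
have [[b [c [abc bU cU]]]|irr] :=
  EM (exists b c, [/\ a = b * c, b \isn't a GRing.unit &
                      c \isn't a GRing.unit]).
  have b0 : b != 0 by apply: contraNneq a0 => b0; rewrite abc b0 mul0r.
  have dba : (d b < d a)%N by rewrite abc dlt // -abc.
  have [p pI pb] := IHn b (leq_trans dba dan) b0 bU.
  by exists p => //; rewrite abc; apply: divides_mulr.
exists a; last by exists 1; rewrite mulr1.
split=> // b c abc; have [bU|bU] := boolP (b \is a GRing.unit); first by left.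
have [cU|cU] := boolP (c \is a GRing.unit); first by right.
by case: irr; exists b, c.
Qed.

End Divisibility.

Lemma field_factorial (K : fieldType) : factorial_domain K.
Proof.
exists (fun=> 0%N); split=> //.
  by move=> a b; rewrite mulf_eq0 negb_or unitfE => /andP[_ ->].
by move=> a [a0]; rewrite unitfE a0.
Qed.

Section Gauss.
Variable R : idomainType.
Implicit Types (p : R) (A B F G : {poly R}).

Lemma poly_split_lead A : A != 0 ->
  exists2 B : {poly R}, (size B < size A)%N &
    A = B + (lead_coef A)%:P * 'X^((size A).-1).
Proof.
move=> A0; have sA : size A = (size A).-1.+1 by rewrite prednK // size_poly_gt0.
exists (\poly_(i < (size A).-1) A`_i); first by rewrite sA ltnS size_poly.
rewrite -[LHS]coefK {1}sA poly_def big_ord_recr /= -poly_def.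
by rewrite lead_coefE mul_polyC.
Qed.

(** When [p] divides [A * B] it divides the product of the leading
    coefficients, hence one of them, and that leading term can be dropped. *)
Lemma prime_polyC p : prime_elt p -> prime_elt p%:P.
Proof.
move=> pP A B; have [n] := ubnP (size A + size B).
elim: n A B => // n IHn A B sAB pAB.
have [->|A0] := eqVneq A 0; first by left; exists 0; rewrite mulr0.
have [->|B0] := eqVneq B 0; first by right; exists 0; rewrite mulr0.
wlog [c lcA] : A B A0 B0 sAB pAB / divides p (lead_coef A).
  move=> wl; case: (pAB) => C /(congr1 lead_coef).
  rewrite !lead_coefM lead_coefC => lc.
  case: (pP (lead_coef A) (lead_coef B)); first by exists (lead_coef C).
    exact: wl.
  by move=> /(wl B A B0 A0); rewrite addnC mulrC or_comm; apply.
have [A' sA' defA] := poly_split_lead A0.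
have pl : divides p%:P ((lead_coef A)%:P * 'X^((size A).-1)).
  by rewrite lcA polyCM -mulrA; exists (c%:P * 'X^((size A).-1)).
have pA'B : divides p%:P (A' * B).
  have -> : A' * B = A * B + - ((lead_coef A)%:P * 'X^((size A).-1) * B).
    by rewrite {1}defA mulrDl addrK.
  by apply: dividesD => //; apply/dividesN/divides_mulr.
have [|pA'|] := IHn A' B _ pA'B; last by right.
  by apply: leq_trans (ltnSE sAB); rewrite ltn_add2r.
by left; rewrite defA; apply: dividesD.
Qed.

(** The content of [A] is a unit, said without greatest common divisors. *)
Definition primitive_poly A : Prop :=
  forall p, irreducible_elt p -> ~ divides p%:P A.

Hypothesis factR : factorial_domain R.

(** Gauss's lemma: irreducible constants are prime, hence can be cancelled one
    at a time. *)
Lemma primitive_divides_scaled A B (c : R) :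
  primitive_poly A -> c != 0 -> divides A (c%:P * B) -> divides A B.
Proof.
move=> primA; case: (factR) => d [_ dlt irrP]; have [n] := ubnP (d c).
elim: n c => // n IHn c /ltnSE dcn c0 [Q eQ].
have [cU|cU] := boolP (c \is a GRing.unit).
  exists (c^-1%:P * Q); rewrite mulrCA -eQ mulrA -polyCM mulVr //.
  by rewrite mul1r.
have [p pI [c' ec]] := irreducible_factor factR c0 cU.
have [p0 pU _] := pI.
have c'0 : c' != 0 by apply: contraNneq c0 => c'0; rewrite ec c'0 mulr0.
have [|/primA []//|[Q' eQ']] := prime_polyC (irrP _ pI) (b := A) (c := Q).
  by rewrite -eQ ec polyCM -mulrA; exists (c'%:P * B).
apply: (IHn c') => //.
  by apply: leq_trans dcn; rewrite ec mulrC dlt // mulrC -ec.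
exists Q'; have pC0 : p%:P != 0 :> {poly R} by rewrite polyC_eq0.
by apply: (mulfI pC0); rewrite [RHS]mulrCA -eQ' -eQ ec polyCM mulrA.
Qed.

Lemma primitive_part A : A != 0 ->
  exists c A', [/\ c != 0, primitive_poly A' & A = c%:P * A'].
Proof.
case: (factR) => d [_ dlt irrP]; have [n] := ubnP (d (lead_coef A)).
elim: n A => // n IHn A /ltnSE dAn A0.
have [[p [pI [A1 eA]]]|primA] :=
    EM (exists p, irreducible_elt p /\ divides p%:P A); last first.
  exists 1, A; split; rewrite ?oner_eq0 ?mul1r // => p pI pA.
  by apply: primA; exists p.
have [p0 pU _] := pI.
have A10 : A1 != 0 by apply: contraNneq A0 => A10; rewrite eA A10 mulr0.
have [|c [A' [c0 primA' eA']]] := IHn A1 _ A10.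
  apply: leq_trans dAn; rewrite eA lead_coefM lead_coefC mulrC dlt //.
  by rewrite mulf_neq0 ?lead_coef_eq0.
by exists (p * c), A'; rewrite mulf_neq0 // polyCM -mulrA -eA'.
Qed.

Lemma polyC_unit (a : R) : (a%:P \is a GRing.unit) = (a \is a GRing.unit).
Proof.
rewrite poly_unitE coefC eqxx size_polyC.
by case: (eqVneq a 0) => [->|_] //=; rewrite unitr0.
Qed.

Lemma irreducible_primitive F :
  irreducible_elt F -> (1 < size F)%N -> primitive_poly F.
Proof.
move=> [F0 FU Firr] sF p [p0 pU _] [Q eF].
have := sF; rewrite eF size_Cmul // => sQ.
have [|] := Firr _ _ eF; first by rewrite polyC_unit (negbTE pU).
by rewrite poly_unitE => /andP[/eqP sQ1]; rewrite sQ1 in sQ.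
Qed.

(** The greatest common divisor of [F] and [G] over the fraction field has an
    associate in the ideal they generate; its primitive part divides both, so
    it is constant as soon as [F] is irreducible and does not divide [G]. *)
Lemma irreducible_Bezout F G :
  irreducible_elt F -> ~ divides F G ->
  exists U V r, r != 0 /\ U * F + V * G = r%:P.
Proof.
move=> FI FG; have [F0 FU Firr] := FI.
have [sF|sF] := leqP (size F) 1.
  exists 1, 0, F`_0; rewrite mul1r mul0r addr0 -size1_polyC //; split=> //.
  by rewrite -polyC_eq0 -size1_polyC.
have primF := irreducible_primitive FI sF.
have [[U V] /= eUV] := Bezoutp F G.
set m := U * F + V * G in eUV.
have mF : m %| F by rewrite (eqp_dvdl _ eUV) dvdp_gcdl.
have mG : m %| G by rewrite (eqp_dvdl _ eUV) dvdp_gcdr.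
have m0 : m != 0.
  by apply: contraNneq F0 => m0; move: mF; rewrite m0 dvd0p.
have [c [m' [c0 primm' em]]] := primitive_part m0.
have m'_div H : m %| H -> divides m' H.
  move=> /Pdiv.Idomain.dvdpP[[a Q] /= a0 eH].
  apply: (primitive_divides_scaled primm' a0).
  by exists (Q * c%:P); rewrite mul_polyC eH em mulrA mulrC.
have [t eF] := m'_div _ mF; have [m'U|tU] := Firr _ _ eF.
  have : size m' == 1%N by move: m'U; rewrite poly_unitE => /andP[].
  move=> /size_poly1P[b b0 em']; exists U, V, (c * b).
  by split; rewrite ?mulf_neq0 // -/m em em' polyCM.
have [s eG] := m'_div _ mG; case: FG; exists (t^-1 * s).
by rewrite eF mulrA mulrK.
Qed.

Lemma poly_factorial : factorial_domain {poly R}.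
Proof.
case: (factR) => d [dle dlt irrP].
(* a nonunit factor is either nonconstant, and increases the size, or a nonunit
   constant, and then divides the leading coefficient *)
exists (fun A => size A + d (lead_coef A))%N; split.
- move=> A B; rewrite mulf_eq0 negb_or => /andP[A0 B0].
  rewrite lead_coefM leq_add // ?dle ?mulf_neq0 ?lead_coef_eq0 //.
  by rewrite size_mul // (polySpred B0) addnS leq_addr.
- move=> A B; rewrite mulf_eq0 negb_or => /andP[A0 B0] BU.
  have lAB : lead_coef A * lead_coef B != 0.
    by rewrite mulf_neq0 ?lead_coef_eq0.
  rewrite lead_coefM size_mul // (polySpred B0) addnS /=.
  have [sB|sB] := ltnP 1 (size B).
    rewrite -addSn leq_add ?dle // -addn1 leq_add2l -ltnS -polySpred //.
  have sB1 : size B == 1%N by rewrite eqn_leq sB size_poly_gt0.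
  rewrite (eqP sB1) addn0 ltn_add2l dlt //.
  by move: BU; rewrite poly_unitE sB1 /= lead_coefE (eqP sB1).
move=> F FI; have [F0 FU Firr] := FI.
have [sF|sF] := ltnP 1 (size F); last first.
  have /size_poly1P[p p0 eF] : size F == 1%N.
    by rewrite eqn_leq sF size_poly_gt0.
  rewrite eF; apply: prime_polyC; apply: irrP; split=> //.
    by rewrite -polyC_unit -eF.
  move=> b c ebc; rewrite -!polyC_unit; apply: Firr.
  by rewrite eF ebc polyCM.
move=> A B FAB; have [|nFA] := EM (divides F A); first by left.
have [U [V [r [r0 eUV]]]] := irreducible_Bezout FI nFA.
right; apply: (primitive_divides_scaled (irreducible_primitive FI sF) r0).
rewrite -eUV mulrDl; apply: dividesD.
  by exists (U * B); rewrite mulrAC mulrC mulrA.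
by rewrite -mulrA; apply: divides_mull.
Qed.

End Gauss.

(** * Polynomials in three variables as iterated polynomials *)

Lemma poly_vanishing (K : idomainType) (p : {poly K}) (s : nat -> K) :
  injective s -> (forall n, p.[s n] = 0) -> p = 0.
Proof.
move=> injs ps; apply/eqP/negPn/negP => p0.
have /= := @max_poly_roots _ p (map s (iota 0 (size p))) p0.
rewrite size_map size_iota ltnn map_inj_uniq ?iota_uniq //.
move=> h; suff: false by []; apply: h => //.
by apply/allP => x /mapP[n _ ->]; apply/rootP.
Qed.

Lemma poly2_vanishing (K : idomainType) (r : {poly {poly K}}) (s t : nat -> K) :
  injective s -> injective t -> (forall m n, r.[(s m)%:P].[t n] = 0) -> r = 0.
Proof.
move=> injs injt rst; apply: (@poly_vanishing _ _ (fun m => (s m)%:P)).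
  by move=> m n /polyC_inj/injs.
by move=> m; apply: poly_vanishing injt _.
Qed.

Lemma poly_nat_ext (K : numDomainType) (p q : {poly K}) :
  (forall n, p.[n%:R] = q.[n%:R]) -> p = q.
Proof.
move=> pq; apply/eqP; rewrite -subr_eq0; apply/eqP.
apply: (@poly_vanishing _ _ (fun n => n%:R)) => [m n /eqP|n].
  by rewrite eqr_nat => /eqP.
by rewrite !hornerE pq subrr.
Qed.

Lemma divisor_of_constant (K : fieldType) (p q : {poly K}) d :
  d != 0 -> p * q = d%:P -> exists c, forall t, p.[t] = c.
Proof.
move=> d0 e; have := polyC_unit d.
rewrite -e unitrM unitfE d0 => /andP[].
rewrite poly_unitE => /andP[/size_poly1P[c _ ->] _] _.
by exists c => t; rewrite hornerC.
Qed.

Lemma mpoly_morph_ext (K S : comNzRingType) n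
    (f g : {rmorphism mpoly n K -> S}) :
  (forall c, f (mpolyC n c) = g (mpolyC n c)) ->
  (forall i, f (mpolyX K (mnm1 i)) = g (mpolyX K (mnm1 i))) -> f =1 g.
Proof.
move=> fgC fgX p; rewrite (mpolyE p) !rmorph_sum; apply: eq_bigr => m _.
rewrite -!mul_mpolyC !rmorphM fgC mpolyXE_id !rmorph_prod; congr (_ * _).
by apply: eq_bigr => i _; rewrite !rmorphXn fgX.
Qed.

Lemma poly_morph_ext (A B : comNzRingType) (f g : {rmorphism {poly A} -> B}) :
  (forall c, f c%:P = g c%:P) -> f 'X = g 'X -> f =1 g.
Proof.
move=> fgC fgX; elim/poly_ind => [|p c IHp]; first by rewrite !rmorph0.
by rewrite !rmorphD !rmorphM fgC fgX IHp.
Qed.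

Section HornerMap.
Variables (A B : comNzRingType) (f : {rmorphism A -> B}) (u : B).

Let fu : {rmorphism {poly A} -> B} := horner_eval u \o map_poly f.

Lemma horner_map_polyC c : fu c%:P = f c.
Proof. by rewrite /fu /= /horner_eval map_polyC hornerC. Qed.

Lemma horner_map_polyX : fu 'X = u.
Proof. by rewrite /fu /= /horner_eval map_polyX hornerX. Qed.

End HornerMap.

Section IteratedPolynomials.
Variables (K : fieldType) (s : {perm 'I_3}).

Definition iter_var (i : 'I_3) : {poly {poly {poly K}}} :=
  [:: 'X; 'X%:P; 'X%:P%:P]`_i.

Definition iter_const : {rmorphism K -> {poly {poly {poly K}}}} :=
  polyC \o polyC \o polyC.

(** The permutation chooses the variable that becomes the outermost one, which
    is the one that elimination removes. *)
Definition iter_poly : {rmorphism mpoly 3 K -> {poly {poly {poly K}}}} :=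
  mmap iter_const (fun i => iter_var (s i)).

Definition flat_var (i : 'I_3) : mpoly 3 K := mpolyX K (mnm1 ((s^-1)%g i)).

Definition flat1 : {rmorphism {poly K} -> mpoly 3 K} :=
  horner_eval (flat_var (inord 2%N)) \o map_poly (@mpolyC 3 K).
Definition flat2 : {rmorphism {poly {poly K}} -> mpoly 3 K} :=
  horner_eval (flat_var (inord 1%N)) \o map_poly flat1.
Definition flat_poly : {rmorphism {poly {poly {poly K}}} -> mpoly 3 K} :=
  horner_eval (flat_var (inord 0%N)) \o map_poly flat2.

Lemma horner_iter_poly (F : mpoly 3 K) (u : 'I_3 -> K) :
  (iter_poly F).[(u (inord 0%N))%:P%:P].[(u (inord 1%N))%:P].[u (inord 2%N)]
  = meval (u \o s) F.
Proof.
pose ev3 : {rmorphism {poly {poly {poly K}}} -> K} :=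
  horner_eval (u (inord 2%N)) \o horner_eval (u (inord 1%N))%:P
  \o horner_eval (u (inord 0%N))%:P%:P.
pose f : {rmorphism mpoly 3 K -> K} := ev3 \o iter_poly.
pose g : {rmorphism mpoly 3 K -> K} := meval (u \o s).
apply: (@mpoly_morph_ext _ _ _ f g) => [c|i] /=.
  by rewrite mmapC /= mevalC /horner_eval !hornerC.
rewrite mmapX mmap1U mevalXU /= /iter_var /horner_eval.
by case: (s i) => [[|[|[|k]]] ki] //=; rewrite !hornerE; congr u;
  apply: val_inj; rewrite /= inordK.
Qed.

Let flatC c : flat_poly c%:P = flat2 c.
Proof. exact: horner_map_polyC. Qed.
Let flatX : flat_poly 'X = flat_var (inord 0%N).
Proof. exact: horner_map_polyX. Qed.
Let flat2C c : flat2 c%:P = flat1 c.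
Proof. exact: horner_map_polyC. Qed.
Let flat2X : flat2 'X = flat_var (inord 1%N).
Proof. exact: horner_map_polyX. Qed.
Let flat1C c : flat1 c%:P = mpolyC 3 c.
Proof. exact: horner_map_polyC. Qed.
Let flat1X : flat1 'X = flat_var (inord 2%N).
Proof. exact: horner_map_polyX. Qed.
Let flatE := (flatC, flatX, flat2C, flat2X, flat1C, flat1X).

Let iter_polyC c : iter_poly (mpolyC 3 c) = iter_const c.
Proof. by rewrite /iter_poly /= mmapC. Qed.

Let iter_polyX i : iter_poly (mpolyX K (mnm1 i)) = iter_var (s i).
Proof. by rewrite /iter_poly /= mmapX mmap1U. Qed.

Lemma iter_polyK : cancel (iter_poly) (flat_poly).
Proof.
pose f : {rmorphism mpoly 3 K -> mpoly 3 K} := flat_poly \o iter_poly.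
apply: (@mpoly_morph_ext _ _ _ f idfun) => [c|i].
  change (flat_poly (iter_poly (mpolyC 3 c)) = mpolyC 3 c).
  by rewrite iter_polyC !flatE.
change (flat_poly (iter_poly (mpolyX K (mnm1 i))) = mpolyX K (mnm1 i)).
have -> : mpolyX K (mnm1 i) = flat_var (s i) by rewrite /flat_var permK.
rewrite {1}/flat_var permK iter_polyX.
case: (s i) => [[|[|[|k]]] ki] //.
- apply: (etrans flatX); congr flat_var; apply: val_inj; rewrite /= inordK //.
- apply: (etrans (flatC 'X)); rewrite flatE.
  by congr flat_var; apply: val_inj; rewrite /= inordK.
apply: (etrans (flatC 'X%:P)); rewrite !flatE.
by congr flat_var; apply: val_inj; rewrite /= inordK.
Qed.

Lemma flat_polyK : cancel (flat_poly) (iter_poly).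
Proof.
have varE j : (j < 3)%N ->
    iter_poly (flat_var (inord j)) = iter_var (inord j).
  by move=> j3; rewrite iter_polyX permKV.
pose f : {rmorphism {poly {poly {poly K}}} -> {poly {poly {poly K}}}} :=
  iter_poly \o flat_poly.
apply: (@poly_morph_ext _ _ f idfun) => [c|]; last first.
  change (iter_poly (flat_poly 'X) = 'X).
  by rewrite flatE varE // /iter_var inordK.
change (iter_poly (flat_poly c%:P) = c%:P); rewrite flatE; move: c.
apply: (@poly_morph_ext _ _ (iter_poly \o flat2) polyC) => [c|].
  change (iter_poly (flat2 c%:P) = c%:P%:P); rewrite flatE; move: c.
  apply: (@poly_morph_ext _ _ (iter_poly \o flat1) (polyC \o polyC)).
    move=> c; change (iter_poly (flat1 c%:P) = c%:P%:P%:P).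
    by rewrite flatE iter_polyC.
  change (iter_poly (flat1 'X) = 'X%:P%:P).
  by rewrite flatE varE // /iter_var inordK.
change (iter_poly (flat2 'X) = 'X%:P).
by rewrite flatE varE // /iter_var inordK.
Qed.

Lemma iter_poly_irreducible F :
  irreducible_pol F -> irreducible_elt (iter_poly F).
Proof.
move=> [F0 FU Firr]; split.
- by apply: contraNneq F0 => F0; rewrite -(iter_polyK F) F0 rmorph0.
- by apply: contraNN FU => /(rmorph_unit (flat_poly)); rewrite iter_polyK.
move=> A B eF; have : F = flat_poly A * flat_poly B.
  by rewrite -rmorphM -eF iter_polyK.
by move=> /Firr[] /(rmorph_unit (iter_poly)); rewrite flat_polyK; [left|right].
Qed.

(** Elimination: a Bezout relation over polynomials in two of the variables
    confines the projection of the common zeros to a plane curve. *)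
Lemma common_zeros_projection F H :
  irreducible_pol F -> ~ mdivides F H ->
  exists2 r : {poly {poly K}}, r != 0 &
    forall p, ev F p = 0 -> ev H p = 0 ->
      r.[(p ((s^-1)%g (inord 1%N)) 0)%:P].[p ((s^-1)%g (inord 2%N)) 0] = 0.
Proof.
move=> FI nFH; have [|U [V [r [r0 eUV]]]] := irreducible_Bezout
    (poly_factorial (poly_factorial (field_factorial K)))
    (iter_poly_irreducible FI) (G := iter_poly H).
  move=> [Q eQ]; case: nFH; exists (flat_poly Q).
  by rewrite -[H]iter_polyK eQ rmorphM iter_polyK.
exists r => // p Fp Hp; pose u i := p ((s^-1)%g i) 0.
pose h A := A.[(u (inord 0%N))%:P%:P].[(u (inord 1%N))%:P].[u (inord 2%N)].
have evE G : h (iter_poly G) = ev G p.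
  by rewrite /h horner_iter_poly; apply: meval_eq => i; rewrite /u /= permK.
have := congr1 h eUV; rewrite {1}/h !(hornerD, hornerM) -!/(h _) !evE Fp Hp.
by rewrite !mulr0 addr0 /h hornerC.
Qed.

End IteratedPolynomials.

Lemma mpoly_nat_ext (K : numFieldType) (F G : mpoly 3 K) :
  (forall x y z : nat, ev F (\col_i [:: x%:R; y%:R; z%:R]`_i) =
                       ev G (\col_i [:: x%:R; y%:R; z%:R]`_i)) -> F = G.
Proof.
move=> FG; apply: (can_inj (@iter_polyK K 1%g)).
apply/eqP; rewrite -subr_eq0 -rmorphB; apply/eqP.
have natinj : injective (fun n => n%:R : K).
  by move=> m n /eqP; rewrite eqr_nat => /eqP.
have natinjC (A : numDomainType) : injective (fun n => n%:R%:P : {poly A}).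
  by move=> m n /polyC_inj/eqP; rewrite eqr_nat => /eqP.
apply: (@poly_vanishing _ _ (fun n => n%:R%:P%:P)).
  by move=> m n /polyC_inj/natinjC.
move=> x; apply: (poly2_vanishing natinj natinj) => y z.
pose u (i : 'I_3) : K := [:: x%:R; y%:R; z%:R]`_i.
have -> : x%:R = u (inord 0%N) by rewrite /u inordK.
have -> : y%:R = u (inord 1%N) by rewrite /u inordK.
have -> : z%:R = u (inord 2%N) by rewrite /u inordK.
rewrite horner_iter_poly mevalB.
have evE H : meval (u \o (1%g : {perm 'I_3})) H = ev H (\col_i u i).
  by apply: meval_eq => i; rewrite /= perm1 mxE.
by rewrite !evE FG subrr.
Qed.

(** * Polynomials vanishing on a surface *)

Lemma perm_extending_pair (f : 'I_2 -> 'I_3) :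
  injective f ->
  exists s : {perm 'I_3}, s (inord 1%N) = f 0 /\ s (inord 2%N) = f 1.
Proof.
move=> injf; pose t := tperm (inord 1%N) (f 0).
have n12 : (inord 1%N : 'I_3) != inord 2%N.
  by apply/eqP => /(congr1 val); rewrite /= !inordK.
exists (t * tperm (t (inord 2%N)) (f 1%R))%g; rewrite !permM.
split; last exact: tpermL.
have tf0 : t (inord 1%N) = f 0 by rewrite /t tpermL.
rewrite tf0.
rewrite tpermD //; first by rewrite -tf0 (inj_eq perm_inj) eq_sym.
by rewrite (inj_eq injf).
Qed.

(** A polynomial that vanishes on the surface without being a multiple of [F]
    would, by elimination, confine the projection of the surface to a plane
    curve; but a two-dimensional surface has a projection containing a disc. *)
Lemma vanishing_divides (R : realType) (F H : pol3 R) :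
  irreducible_pol F -> fat_projection (zeros F) 2 ->
  zeros F `<=` zeros H -> mdivides F H.
Proof.
move=> FI [f injf [c]] /nbhs_ballP[e /= e0 ceS] FH.
apply: contrapT => nFH.
have [s [s1 s2]] := perm_extending_pair injf.
have [r r0 rP] := common_zeros_projection (s^-1)%g FI nFH.
(* a grid inside the disc, infinite in both directions *)
pose a k n : R := c k 0 + e / n.+2%:R.
have inja k : injective (a k).
  move=> m n /addrI /mulfI; rewrite gt_eqF // => /(_ isT) /invr_inj /eqP.
  by rewrite eqr_nat => /eqP[].
move/eqP: r0; apply; apply: (poly2_vanishing (inja 0) (inja 1)) => m n.
have /ceS[p Fp pE] : ball c e (\col_k a k (if k == 0 then m else n)).
  split=> // i j; rewrite ord1 mxE /a; move: (if _ then _ else _) => {}k.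
  rewrite /ball /= opprD addrA subrr add0r normrN gtr0_norm ?divr_gt0 //.
  by rewrite ltr_pdivrMr // ltr_pMr // ltr1n.
have := rP p Fp (FH _ Fp); rewrite invgK s1 s2.
have pk k : p (f k) 0 = a k (if k == 0 then m else n).
  by have /matrixP/(_ k 0) := pE; rewrite !mxE.
by rewrite !pk.
Qed.

(** * Evaluation, affine substitution and behaviour at infinity *)

Section Evaluation.
Variable K : fieldType.
Implicit Types (F G : pol3 K) (p u v l : 'cV[K]_3).

Lemma evM F G p : ev (F * G) p = ev F p * ev G p.
Proof. exact: mevalM. Qed.

Lemma ev_linear_form l p : ev (linear_form l) p = \sum_i l i 0 * p i 0.
Proof.
rewrite /ev /linear_form raddf_sum; apply: eq_bigr => i _ /=.
by rewrite mevalZ mevalXU.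
Qed.

(** Restriction to a curve parametrized by polynomials: questions in three
    variables reduce to univariate ones. *)
Definition along (c : 'cV[{poly K}]_3) : {rmorphism pol3 K -> {poly K}} :=
  mmap polyC (fun i => c i 0).

Lemma horner_along c F t : (along c F).[t] = ev F (\col_i (c i 0).[t]).
Proof.
pose f : {rmorphism pol3 K -> K} := horner_eval t \o along c.
pose g : {rmorphism pol3 K -> K} := meval (fun i => (c i 0).[t]).
transitivity (g F); last by apply: meval_eq => i; rewrite mxE.
apply: (@mpoly_morph_ext _ _ _ f g) => [a|i] /=.
  by rewrite mmapC mevalC /horner_eval hornerC.
by rewrite mmapX mmap1U mevalXU.
Qed.

Definition affine_comp (M : 'M[K]_3) v F : pol3 K :=
  comp_mpoly [tuple linear_form (row i M)^T + mpolyC 3 (v i 0) | i < 3] F.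

Lemma ev_affine_comp M v F p : ev (affine_comp M v F) p = ev F (M *m p + v).
Proof.
rewrite /ev comp_mpoly_meval; apply: meval_eq => i.
rewrite tnth_mktuple mevalD mevalC -/(ev _ p) ev_linear_form !mxE.
by congr (_ + _); apply: eq_bigr => j _; rewrite !mxE.
Qed.

Lemma ev_homog d F t p :
  F \is ishomog1 d mdeg -> ev F (t *: p) = t ^+ d * ev F p.
Proof.
move=> /dhomogP homF; rewrite /ev !mevalE mulr_sumr !big_seq.
apply: eq_bigr => m /homF <-; rewrite mulrCA; congr (_ * _).
have -> : t ^+ mdeg m = \prod_i t ^+ m i.
  by rewrite prodrXr; congr (_ ^+ _); exact: mdegE.
rewrite -big_split /=.
by apply: eq_bigr => i _; rewrite mxE exprMn.
Qed.

(** [t ^+ N * F (u / t + v)] extends to a polynomial in [t], whose value at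
    [t = 0] is [F_N u]: the leading form is what remains of [F] at infinity. *)
Lemma top_form_at_infinity F u v :
  exists2 g : {poly K}, g.[0] = ev (top_form F) u &
    forall t, t != 0 ->
      g.[t] = t ^+ (mmeasure mdeg F).-1 * ev F (t^-1 *: u + v).
Proof.
set N := (mmeasure mdeg F).-1.
have degN m : m \in msupp F -> (mdeg m <= N)%N.
  by move=> /(mmeasure_mnm_lt mdeg) lt; rewrite -ltnS (ltn_predK lt).
exists (\sum_(m <- msupp F) mcoeff m F *:
          ('X^(N - mdeg m) * \prod_i ((u i 0)%:P + (v i 0)%:P * 'X) ^+ m i)).
  rewrite horner_sum /ev /top_form -/N /pihomog raddf_sum /= [RHS]big_mkcond /=.
  rewrite !big_seq; apply: eq_bigr => m /degN mN.
  rewrite hornerZ hornerM horner_prod hornerXn.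
  have [dm|dm] := eqVneq (mdeg m) N; last first.
    by rewrite expr0n subn_eq0 leqNgt ltn_neqAle dm mN mul0r mulr0.
  rewrite dm subnn mul1r mevalZ mevalX; congr (_ * _).
  by apply: eq_bigr => i _; rewrite horner_exp !hornerE.
move=> t t0; rewrite horner_sum /ev mevalE mulr_sumr !big_seq.
apply: eq_bigr => m /degN mN; rewrite hornerZ mulrCA; congr (_ * _).
rewrite hornerM hornerXn horner_prod -[in RHS](subnK mN) exprD -mulrA.
congr (_ * _).
have -> : t ^+ mdeg m = \prod_i t ^+ m i by rewrite prodrXr mdegE.
rewrite -big_split /=.
apply: eq_bigr => i _; rewrite horner_exp !hornerE !mxE -exprMn mulrDr.
by rewrite mulrA mulfV // mul1r [t * _]mulrC.
Qed.

Lemma top_form_neq0 F : F != 0 -> top_form F != 0.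
Proof.
move=> F0; apply: contraNneq (F0) => T0.
have dlead : mdeg (mlead F) = (mmeasure mdeg F).-1 by rewrite -(mlead_deg F0).
rewrite -mleadc_eq0.
rewrite [X in mcoeff _ X](pihomog_partitionE (leqnn (mmeasure mdeg F))).
rewrite raddf_sum /= big1 // => d _.
have [dN|dN] := eqVneq (d : nat) (mmeasure mdeg F).-1.
  by rewrite dN -/(top_form F) T0 mcoeff0.
by apply: (dhomog_nemf_coeff (pihomogP mdeg d F)); rewrite /= dlead eq_sym.
Qed.

End Evaluation.

(** * Invariance under parabolic rotations *)

Definition vec3 (A : nmodType) (x y z : A) : 'cV[A]_3 := \col_i [:: x; y; z]`_i.

Lemma ord3P (P : 'I_3 -> Prop) : P 0 -> P 1 -> P 2%:R -> forall i, P i.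
Proof.
move=> P0 P1 P2 [[|[|[|i]]] ltn] //; [move: P0|move: P1|move: P2];
by congr P; apply: val_inj.
Qed.

Lemma sum3 (A : nmodType) (f : 'I_3 -> A) :
  \sum_i f i = f 0 + f 1 + f 2%:R.
Proof.
rewrite !big_ord_recl big_ord0 addr0 addrA.
by congr (_ + _ + _); congr f; apply: val_inj.
Qed.

Lemma vec3_eta (A : nmodType) (p : 'cV[A]_3) :
  p = vec3 (p 0 0) (p 1 0) (p 2%:R 0).
Proof. by apply/matrixP => i j; rewrite ord1 mxE; move: i; apply: ord3P. Qed.

Section RigidMotion.
Variables (R : realType) (T : rigid_motion R).
Implicit Types (p q : 'cV[R]_3).

Lemma rot_orthogonalr : Defs.rot T *m (Defs.rot T)^T = 1%:M.
Proof. exact/mulmx1C/rot_orthogonal. Qed.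

Definition unmove p := (Defs.rot T)^T *m (p - trans T).

Lemma moveK : cancel (move T) unmove.
Proof. by move=> p; rewrite /unmove addrK mulmxA rot_orthogonal mul1mx. Qed.

Lemma unmoveK : cancel unmove (move T).
Proof. by move=> p; rewrite /move mulmxA rot_orthogonalr mul1mx subrK. Qed.

Lemma par_mxE (a x y z : R) :
  par_mx a *m vec3 x y z =
  vec3 x (a * x + y) (a ^+ 2 / 2%:R * x + a * y + z).
Proof.
apply/matrixP => i j; rewrite ord1 !mxE sum3 !mxE /=.
by move: i; apply: ord3P; rewrite /= ?mul1r ?mul0r ?addr0.
Qed.

Lemma par_mxVK a :
  cancel (mulmx (par_mx (- a))) (mulmx (par_mx a) : 'cV[R]_3 -> _).
Proof.
by move=> p; rewrite (vec3_eta p) !par_mxE; congr vec3; field.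
Qed.

Definition par_act a p := unmove (par_mx a *m move T p).

Lemma par_actVK a : cancel (par_act (- a)) (par_act a).
Proof. by move=> p; rewrite /par_act unmoveK par_mxVK moveK. Qed.

Variable F : pol3 R.
Hypothesis Firr : irreducible_pol F.
Hypothesis Ffat : fat_projection (zeros F) 2.
Hypothesis Finv : forall a : R,
  [set par_mx a *m p | p in move T @` zeros F] = move T @` zeros F.

Lemma zeros_par_act a : zeros F `<=` [set p | zeros F (par_act a p)].
Proof.
move=> p Fp /=.
have : [set par_mx a *m q | q in move T @` zeros F] (par_mx a *m move T p).
  by exists (move T p) => //; exists p.
by rewrite Finv => -[r Fr e]; rewrite /par_act -e moveK.
Qed.

Definition par_pull a (G : pol3 R) : pol3 R :=
  affine_comp ((Defs.rot T)^T *m par_mx a *m Defs.rot T)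
    ((Defs.rot T)^T *m (par_mx a *m trans T - trans T)) G.

Lemma ev_par_pull a G p : ev (par_pull a G) p = ev G (par_act a p).
Proof.
rewrite ev_affine_comp /par_act /unmove /move; congr (ev G _).
by rewrite !(mulmxN, mulmxDr) !mulmxA addrA.
Qed.

Lemma mpoly_ext (G H : pol3 R) : (forall p, ev G p = ev H p) -> G = H.
Proof. by move=> GH; apply: mpoly_nat_ext => x y z; apply: GH. Qed.

(** [F] divides its transforms by [a] and by [- a], since they vanish on the
    surface; the two cofactors are inverse to each other up to a change of
    variables, hence they are units. *)
Lemma par_act_semi_invariant a :
  exists c, forall p, ev F (par_act a p) = c * ev F p.
Proof.
have div b : mdivides F (par_pull b F).
  apply: vanishing_divides => // p /(zeros_par_act b) /=.
  by rewrite /zeros /= ev_par_pull.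
have [Q eQ] := div (- a); have [Q' eQ'] := div a.
have [F0 _ _] := Firr.
have : 1 = Q' * par_pull a Q.
  apply: (mulfI F0); apply: mpoly_ext => p; rewrite mulr1 mulrA !evM.
  rewrite -evM -eQ' !ev_par_pull -evM -eQ ev_par_pull.
  by rewrite -{2}[a]opprK par_actVK.
rewrite mulrC => /esym/mpoly_intro_unit/andP[/eqP eC _].
exists (mcoeff mnm0 Q') => p.
by rewrite -ev_par_pull eQ' evM mulrC {1}eC /ev mevalC.
Qed.

Lemma exists_nonzero : exists p, ev F p != 0.
Proof.
apply: contrapT => noF; have [/eqP F0 _ _] := Firr; apply: F0.
apply: mpoly_ext => p; rewrite [RHS]meval0.
by apply/eqP/negPn/negP => Fp; apply: noF; exists p.
Qed.

Lemma par_act0 p : par_act 0 p = p.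
Proof.
rewrite /par_act (_ : par_mx 0 *m move T p = move T p) ?moveK //.
by rewrite (vec3_eta (move T p)) par_mxE; congr vec3; field.
Qed.

(** The multiplier is a polynomial in [a], and its values at [a] and [- a] are
    inverse to each other, so it is constant, equal to its value at [0]. *)
Lemma par_act_invariant a p : ev F (par_act a p) = ev F p.
Proof.
have [q Fq] := exists_nonzero.
have [f fE] : exists f : {poly R}, forall t, f.[t] = ev F (par_act t q).
  pose m := move T q; pose c : 'cV[{poly R}]_3 :=
    map_mx polyC (Defs.rot T)^T *m
      (vec3 (m 0 0)%:P ((m 0 0)%:P * 'X + (m 1 0)%:P)
      ((m 0 0 / 2%:R)%:P * 'X ^+ 2 + (m 1 0)%:P * 'X + (m 2%:R 0)%:P)
      - map_mx polyC (trans T)).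
  exists (along c F) => t; rewrite horner_along; congr (ev F _).
  rewrite /par_act -/m (vec3_eta m) par_mxE /unmove.
  apply/matrixP => i j; rewrite ord1 !mxE horner_sum; apply: eq_bigr => k _.
  rewrite !mxE hornerM hornerD hornerN !hornerC; congr (_ * (_ - _)).
  by move: k; apply: ord3P; rewrite /= !hornerE //=; field.
have ff t : f.[t] * f.[- t] = ev F q ^+ 2.
  rewrite !fE; have [c cE] := par_act_semi_invariant t.
  have := cE (par_act (- t) q); rewrite par_actVK cE => e.
  by rewrite mulrAC -e expr2.
have [||c fc] := @divisor_of_constant _ f (f \Po - 'X) (ev F q ^+ 2).
- by rewrite expf_neq0.
- by apply: poly_nat_ext => n; rewrite !hornerE horner_comp !hornerE ff.
have [b bE] := par_act_semi_invariant a.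
have b1 : b = 1.
  by apply: (mulIf Fq); rewrite mul1r -bE -[in RHS](par_act0 q) -!fE !fc.
by rewrite bE b1 mul1r.
Qed.

(** The group maps the line through [unmove 0] with direction given by [p] to
    the one with direction given by [par_mx a *m p]; compare what remains of [F]
    at infinity on the two lines. *)
Lemma top_form_invariant a p :
  ev (top_form F) ((Defs.rot T)^T *m (par_mx a *m p)) =
  ev (top_form F) ((Defs.rot T)^T *m p).
Proof.
have [g g0 gE] := top_form_at_infinity F
  ((Defs.rot T)^T *m (par_mx a *m p)) (unmove 0).
have [h h0 hE] := top_form_at_infinity F ((Defs.rot T)^T *m p) (unmove 0).
rewrite -g0 -h0; congr horner.
apply/eqP; rewrite -subr_eq0; apply/eqP.
apply: (@poly_vanishing _ _ (fun n => n.+1%:R)) => [m n /eqP|n].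
  by rewrite eqr_nat => /eqP[].
rewrite hornerD hornerN gE ?pnatr_eq0 // hE ?pnatr_eq0 //.
have unmoveE s q : s *: ((Defs.rot T)^T *m q) + unmove 0 = unmove (s *: q).
  by rewrite /unmove scalemxAr sub0r mulmxN mulmxBr.
have := par_act_invariant a (unmove (n.+1%:R^-1 *: p)).
by rewrite !unmoveE scalemxAr /par_act unmoveK => ->; rewrite subrr.
Qed.

End RigidMotion.

(** * Invariant quadratic forms and complexification *)

Section ConeForm.
Variable K : fieldType.
Implicit Types (Q : 'M[K]_3) (p : 'cV[K]_3).

Definition coord Q i : pol3 K := linear_form (row i Q)^T.

Lemma ev_coord Q i p : ev (coord Q i) p = (Q *m p) i 0.
Proof.
by rewrite ev_linear_form mxE; apply: eq_bigr => j _; rewrite !mxE.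
Qed.

(** In adapted coordinates the group fixes [x] and [y^2 - 2 x z], so these are,
    up to scalars, the invariant quadratic forms besides [x^2]. *)
Definition cone_form Q (lam : K) : pol3 K :=
  coord Q 1 ^+ 2 - 2%:R *: (coord Q 0 * coord Q 2%:R) - lam *: coord Q 0 ^+ 2.

Definition cone_val (lam : K) (q : 'cV[K]_3) : K :=
  q 1 0 ^+ 2 - 2%:R * (q 0 0 * q 2%:R 0) - lam * q 0 0 ^+ 2.

Lemma ev_cone_form Q lam p : ev (cone_form Q lam) p = cone_val lam (Q *m p).
Proof.
rewrite /ev /cone_form !(mevalB, mevalZ, mevalM, rmorphXn) /= -!/(ev _ _).
by rewrite !ev_coord.
Qed.

End ConeForm.

Section Complexification.
Variable R : realType.
Local Notation C := R[i].
Local Notation toC := (real_complex R).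

Lemma ev_complexify (G : pol3 R) p : ev (complexify G) (cvec p) = toC (ev G p).
Proof.
pose f : {rmorphism pol3 R -> C} :=
  meval (fun i => toC (p i 0)) \o map_mpoly toC.
pose g : {rmorphism pol3 R -> C} := toC \o meval (fun i => p i 0).
transitivity (f G); first by apply: meval_eq => i; rewrite mxE.
apply: (@mpoly_morph_ext _ _ _ f g) => [c|i] /=.
  by rewrite map_mpolyC /= !mevalC.
by rewrite map_mpolyX !mevalXU.
Qed.

Lemma complexify_linear_form (l : 'cV[R]_3) :
  complexify (linear_form l) = linear_form (cvec l).
Proof.
rewrite /complexify /linear_form raddf_sum; apply: eq_bigr => i _ /=.
by rewrite map_mpolyZ map_mpolyX mxE.
Qed.

Lemma complexify_coord Q i : complexify (coord Q i) = coord (map_mx toC Q) i.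
Proof. by rewrite complexify_linear_form /cvec -matrix.map_trmx map_row. Qed.

Lemma complexifyB (G H : pol3 R) :
  complexify (G - H) = complexify G - complexify H.
Proof. exact: raddfB. Qed.

Lemma complexifyM (G H : pol3 R) :
  complexify (G * H) = complexify G * complexify H.
Proof. exact: rmorphM. Qed.

Lemma complexifyZ (c : R) (G : pol3 R) :
  complexify (c *: G) = toC c *: complexify G.
Proof. exact: map_mpolyZ. Qed.

Lemma complexify_cone_form Q lam :
  complexify (cone_form Q lam) = cone_form (map_mx toC Q) (toC lam).
Proof.
rewrite /cone_form !expr2 !(complexifyB, complexifyZ, complexifyM).
by rewrite !complexify_coord rmorph_nat.
Qed.

(** The real points are Zariski dense. *)
Lemma cpoly_ext (G H : pol3 C) :
  (forall p : 'cV[R]_3, ev G (cvec p) = ev H (cvec p)) -> G = H.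
Proof.
move=> GH; apply: mpoly_nat_ext => x y z.
have -> : \col_i [:: x%:R; y%:R; z%:R]`_i =
    cvec (\col_i [:: x%:R; y%:R; z%:R : R]`_i).
  apply/matrixP => i j; rewrite !mxE; move: i.
  by apply: ord3P; rewrite /= rmorph_nat.
exact: GH.
Qed.

Lemma complexify_neq0 (G : pol3 R) : G != 0 -> complexify G != 0.
Proof.
apply: contraNneq => G0; apply/eqP; apply: mpoly_ext => p.
have := ev_complexify G p; rewrite G0 /ev !meval0 => /esym/eqP.
by rewrite fmorph_eq0 => /eqP.
Qed.

End Complexification.

(** * Factorization of invariant forms *)

Section InvariantForms.
Variables (R : realType) (T : rigid_motion R) (N : nat) (G : pol3 R).
Local Notation C := R[i].
Local Notation toC := (real_complex R).
Local Notation cQ := (map_mx toC (Defs.rot T)).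
Hypothesis Ghom : G \is ishomog1 N mdeg.
Hypothesis Ginv : forall a p,
  ev G ((Defs.rot T)^T *m (par_mx a *m p)) = ev G ((Defs.rot T)^T *m p).
Hypothesis G0 : G != 0.

(** The orbit of a point with [x != 0] meets the plane [y = 0] at height
    [z - y^2 / 2 x], and homogeneity then scales [x] to [1]. *)
Lemma invariant_form_value :
  exists P : {poly R}, forall p : 'cV[R]_3, p 0 0 != 0 ->
    ev G ((Defs.rot T)^T *m p) =
    p 0 0 ^+ N * P.[(p 1 0 ^+ 2 - 2%:R * (p 0 0 * p 2%:R 0)) / p 0 0 ^+ 2].
Proof.
pose c : 'cV[{poly R}]_3 :=
  map_mx polyC (Defs.rot T)^T *m vec3 1 0 ((- 2%:R^-1)%:P * 'X).
exists (along c G) => p; rewrite (vec3_eta p) !mxE /=.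
move: (p 0 0) (p 1 0) (p 2%:R 0) => x y z x0.
rewrite -(Ginv (- y / x)) par_mxE horner_along -(ev_homog _ _ Ghom).
congr (ev G _); apply/matrixP => i j; rewrite ord1 !mxE horner_sum mulr_sumr.
apply: eq_bigr => k _; rewrite !mxE hornerM !hornerC mulrCA; congr (_ * _).
by move: k; apply: ord3P; rewrite /= !hornerE /=; field.
Qed.

Lemma prod_scaled (A : comNzRingType) (s t : A) (r : seq A) :
  s ^+ size r * \prod_(l <- r) (t - l) = \prod_(l <- r) (s * t - l * s).
Proof.
elim: r => [|l r IHr]; first by rewrite !big_nil mulr1.
by rewrite !big_cons -IHr /= exprS; ring.
Qed.

(** Homogeneity and invariance determine the form by one polynomial [P] in
    [(y^2 - 2 x z) / x^2]; a root [l] of [P] gives the factor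
    [y^2 - 2 x z - l x^2], once the powers of [x] are cleared. *)
Lemma invariant_form_factors :
  exists k (c : C) (r : seq C), c != 0 /\
    complexify G = c *: (coord cQ 0 ^+ k * \prod_(l <- r) cone_form cQ l).
Proof.
have [P PE] := invariant_form_value.
have [r] := closed_field_poly_normal (map_poly toC P).
set c := lead_coef _ => eP.
pose X := coord cQ 0; pose q := \prod_(l <- r) cone_form cQ l.
have evX p : ev X (cvec p) = toC ((Defs.rot T *m p) 0 0).
  by rewrite /X -complexify_coord ev_complexify ev_coord.
have evq p : ev q (cvec p) =
    \prod_(l <- r) cone_val l (cvec (Defs.rot T *m p)).
  rewrite /ev rmorph_prod; apply: eq_bigr => l _.
  by rewrite /= -/(ev _ _) ev_cone_form /cvec map_mxM.
have eG : X ^+ (size r).*2.+1 * complexify G = c *: (X ^+ N.+1 * q).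
  apply: cpoly_ext => p; rewrite /ev mevalZ !mevalM !rmorphXn /= -!/(ev _ _).
  rewrite evX evq ev_complexify.
  have -> : p = (Defs.rot T)^T *m (Defs.rot T *m p).
    by rewrite mulmxA rot_orthogonal mul1mx.
  move: (Defs.rot T *m p) => {}p; rewrite mulmxA rot_orthogonalr mul1mx.
  (* the extra factor [X] makes both sides vanish when [x = 0] *)
  have [x0|x0] := eqVneq (p 0 0) 0.
    by rewrite x0 rmorph0 ![0 ^+ _]expr0n /= !mul0r mulr0.
  rewrite PE // rmorphM rmorphXn /= -horner_map /= eP hornerZ horner_prod.
  have x0' : toC (p 0 0) != 0 by rewrite fmorph_eq0.
  rewrite /cone_val.
  under eq_bigr do rewrite hornerXsubC.
  under [in RHS]eq_bigr do rewrite !mxE.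
  set x := toC (p 0 0) in x0' *; set t := toC (_ / _).
  have tE : x ^+ 2 * t = toC (p 1 0) ^+ 2 - 2%:R * (x * toC (p 2%:R 0)).
    rewrite /t rmorphM fmorphV rmorphXn /= -/x mulrCA mulfV ?expf_neq0 // mulr1.
    by rewrite rmorphB rmorphXn !rmorphM /= rmorph_nat.
  rewrite -tE -prod_scaled -exprM -mul2n exprS exprS.
  by ring.
have cancelX (A B : pol3 C) n : X ^+ n * A = X ^+ n * B -> A = B.
  apply: mulfI; rewrite expf_neq0 //; apply/negP => /eqP X0.
  have := evX ((Defs.rot T)^T *m delta_mx 0 0).
  rewrite X0 /ev meval0 mulmxA rot_orthogonalr mul1mx mxE /= rmorph1 => /eqP.
  by rewrite eq_sym oner_eq0.
have c0 : c != 0.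
  apply/eqP => c0; have /eqP[] := complexify_neq0 G0.
  by apply: (cancelX _ _ (size r).*2.+1); rewrite eG c0 scale0r mulr0.
have [le|lt] := leqP (size r).*2 N.
  exists (N - (size r).*2)%N, c, r; split=> //.
  apply: (cancelX _ _ (size r).*2.+1).
  rewrite eG -scalerAr; congr (c *: _); rewrite mulrA -exprD.
  by congr (X ^+ _ * _); rewrite addSn subnKC.
(* otherwise [X] divides [q], which takes the value [1] at [(0, 1, 0)] *)
have eG' : X ^+ ((size r).*2 - N) * complexify G = c *: q.
  apply: (cancelX _ _ N.+1); rewrite mulrA -exprD -scalerAr -eG.
  by congr (X ^+ _ * _); rewrite addSn subnKC // ltnW.
have := congr1 (fun A => ev A (cvec ((Defs.rot T)^T *m delta_mx 1 0))) eG'.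
rewrite /ev mevalZ mevalM rmorphXn /= -!/(ev _ _) evX evq.
rewrite mulmxA rot_orthogonalr mul1mx mxE /= rmorph0 expr0n subn_eq0.
rewrite leqNgt lt mul0r.
rewrite big1 => [/esym/eqP|l _]; first by rewrite mulr1 (negbTE c0).
by rewrite /cone_val !mxE /= !rmorph0 rmorph1; ring.
Qed.

End InvariantForms.

(** * Irreducibility of the invariant quadratic forms *)

Lemma unit_ev (K : fieldType) (G : pol3 K) p :
  G \is a GRing.unit -> ev G p != 0.
Proof.
move=> /(rmorph_unit (meval (fun i => p i 0))); by rewrite unitfE.
Qed.

Lemma affine_of_msize (K : fieldType) (G : pol3 K) :
  (mmeasure mdeg G <= 2)%N -> exists l a, G = linear_form l + mpolyC 3 a.
Proof.
move=> sG; have degG m : m \in msupp G -> (mdeg m <= 1)%N.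
  by move=> /(mmeasure_mnm_lt mdeg) /leq_trans/(_ sG).
rewrite (mpolyE G) big_seq.
apply: (big_ind (fun A => exists l a, A = linear_form l + mpolyC 3 a))
  => [|A B [l [a ->]] [l' [a' ->]]|m].
- exists 0, 0; rewrite raddf0 addr0 /linear_form big1 // => i _.
  by rewrite mxE scale0r.
- exists (l + l'), (a + a'); rewrite mpolyCD addrACA; congr (_ + _).
  rewrite /linear_form -big_split.
  by apply: eq_bigr => i _; rewrite mxE scalerDl.
move=> /degG; case: (ltngtP (mdeg m) 1%N) => // [|/eqP/mdeg1P[i /eqP ->] _].
  rewrite ltnS leqn0 mdeg_eq0 => /eqP -> _; exists 0, (mcoeff mnm0 G).
  rewrite /linear_form big1 ?add0r => [|i _]; last by rewrite mxE scale0r.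
  by rewrite mpolyX0 -mul_mpolyC mulr1.
exists (mcoeff (mnm1 i) G *: delta_mx i 0), 0.
rewrite raddf0 addr0 /linear_form (bigD1 i) //= big1 => [|j ji].
  by rewrite !mxE !eqxx mulr1 addr0.
by rewrite !mxE (negbTE ji) mulr0 scale0r.
Qed.

Lemma form_matrix_exists (K : numFieldType) (q : pol3 K) :
  q \is ishomog1 2 mdeg -> exists M, form_matrix q M.
Proof.
move=> /dhomogP hq; rewrite (mpolyE q) big_seq.
apply: (big_ind (fun A => exists M, form_matrix A M))
  => [|A B [M [Ms Me]] [M' [Ms' Me']]|m /hq dm].
- by exists 0; split=> [|p]; rewrite ?trmx0 // mulmx0 mul0mx mxE /ev meval0.
- exists (M + M'); split=> [|p]; first by rewrite linearD /= Ms Ms'.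
  by rewrite mulmxDr mulmxDl mxE -Me -Me' /ev mevalD.
have [i mi] : exists i, m i != 0%N.
  apply: contrapT => nomi; suff m0 : m = mnm0 by move: dm; rewrite m0 /= mdeg0.
  apply/mnmP => i; rewrite mnm0E; apply/eqP/negPn/negP => mi.
  by apply: nomi; exists i.
have em : mnm_add (mnm_sub m (mnm1 i)) (mnm1 i) = m by rewrite submK // lep1mP.
have /mdeg1P[j /eqP ej] : mdeg (mnm_sub m (mnm1 i)) == 1%N.
  by move: dm; rewrite /= -{1}em mdegD mdeg1 addn1 => -[->].
rewrite -em ej; set a := mcoeff _ _.
exists ((a / 2%:R) *: (delta_mx i j + delta_mx j i)); split=> [|p].
  by rewrite linearZ /= linearD /= !trmx_delta addrC.
rewrite /ev mevalZ mpolyXD mevalM !mevalXU.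
rewrite -scalemxAr -scalemxAl mulmxDr mulmxDl [RHS]mxE [X in _ = _ * X]mxE.
have deltaE (k l : 'I_3) : (p^T *m delta_mx k l *m p) 0 0 = p k 0 * p l 0.
  rewrite !mxE (bigD1 l) //= big1 ?addr0 => [|k' nk]; rewrite !mxE.
    rewrite (bigD1 k) //= big1 ?addr0 => [|k'' nk'];
      rewrite !mxE ?eqxx ?mulr1 //.
    by rewrite (negbTE nk') mulr0.
  by rewrite big1 ?mul0r // => k'' _; rewrite !mxE (negbTE nk) andbF mulr0.
by rewrite !deltaE; field.
Qed.

Lemma cone_form_homog (K : fieldType) (Q : 'M[K]_3) lam :
  cone_form Q lam \is ishomog1 2 mdeg.
Proof.
have cd i : coord Q i \is ishomog1 1 mdeg.
  by apply: rpred_sum => j _; apply: rpredZ; rewrite dhomogX /= mdeg1.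
rewrite /cone_form; apply: rpredB; [apply: rpredB|].
- exact: dhomogMn (cd _).
- by apply: rpredZ; exact: (dhomogM (cd _) (cd _)).
by apply: rpredZ; exact: dhomogMn (cd _).
Qed.

(** The coefficient of [z^2] shows that one factor does not involve [z]; those
    of [x z], [y z] and [y^2] are then incompatible. *)
Lemma cone_form_not_product (K : numFieldType)
    (a0 a1 a2 a3 b0 b1 b2 b3 lam : K) :
  (forall x y z,
     (a0 + (a1 * x + a2 * y + a3 * z)) * (b0 + (b1 * x + b2 * y + b3 * z)) =
     y ^+ 2 - 2%:R * (x * z) - lam * x ^+ 2) -> False.
Proof.
(* each coefficient is a difference of values at points with small entries *)
wlog a30 : a0 a1 a2 a3 b0 b1 b2 b3 / a3 = 0.
  move=> wl h; have : 2%:R * (a3 * b3) = 0.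
    transitivity
      ((a0 + (a1 * 0 + a2 * 0 + a3 * 1)) * (b0 + (b1 * 0 + b2 * 0 + b3 * 1)) +
       (a0 + (a1 * 0 + a2 * 0 + a3 * -1)) * (b0 + (b1 * 0 + b2 * 0 + b3 * -1))
       - 2%:R * ((a0 + (a1 * 0 + a2 * 0 + a3 * 0)) *
                 (b0 + (b1 * 0 + b2 * 0 + b3 * 0)))).
      by ring.
    by rewrite !h; ring.
  move/eqP; rewrite mulf_eq0 pnatr_eq0 /= mulf_eq0 => /orP[]/eqP e.
    exact: wl e h.
  by apply: (wl b0 b1 b2 b3 a0 a1 a2 a3 e) => x y z; rewrite mulrC h.
move=> h; have ab : a1 * b3 = - 2%:R.
  transitivity
    ((a0 + (a1 * 1 + a2 * 0 + a3 * 1)) * (b0 + (b1 * 1 + b2 * 0 + b3 * 1)) -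
     (a0 + (a1 * 1 + a2 * 0 + a3 * 0)) * (b0 + (b1 * 1 + b2 * 0 + b3 * 0)) -
     (a0 + (a1 * 0 + a2 * 0 + a3 * 1)) * (b0 + (b1 * 0 + b2 * 0 + b3 * 1)) +
     (a0 + (a1 * 0 + a2 * 0 + a3 * 0)) * (b0 + (b1 * 0 + b2 * 0 + b3 * 0))).
    by rewrite a30; ring.
  by rewrite !h; ring.
have a2b3 : a2 * b3 = 0.
  transitivity
    ((a0 + (a1 * 0 + a2 * 1 + a3 * 1)) * (b0 + (b1 * 0 + b2 * 1 + b3 * 1)) -
     (a0 + (a1 * 0 + a2 * 1 + a3 * 0)) * (b0 + (b1 * 0 + b2 * 1 + b3 * 0)) -
     (a0 + (a1 * 0 + a2 * 0 + a3 * 1)) * (b0 + (b1 * 0 + b2 * 0 + b3 * 1)) +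
     (a0 + (a1 * 0 + a2 * 0 + a3 * 0)) * (b0 + (b1 * 0 + b2 * 0 + b3 * 0))).
    by rewrite a30; ring.
  by rewrite !h; ring.
have a2b2 : 2%:R * (a2 * b2) = 2%:R.
  transitivity
    ((a0 + (a1 * 0 + a2 * 1 + a3 * 0)) * (b0 + (b1 * 0 + b2 * 1 + b3 * 0)) +
     (a0 + (a1 * 0 + a2 * -1 + a3 * 0)) * (b0 + (b1 * 0 + b2 * -1 + b3 * 0)) -
     2%:R * ((a0 + (a1 * 0 + a2 * 0 + a3 * 0)) *
             (b0 + (b1 * 0 + b2 * 0 + b3 * 0)))).
    by ring.
  by rewrite !h; ring.
have two0 : 2%:R != 0 :> K by rewrite pnatr_eq0.
have b30 : b3 != 0.
  apply/eqP => b30; move/eqP: ab.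
  by rewrite b30 mulr0 eq_sym oppr_eq0 (negbTE two0).
move/eqP: a2b3; rewrite mulf_eq0 (negbTE b30) orbF => /eqP a20.
by move/eqP: a2b2; rewrite a20 mul0r mulr0 eq_sym (negbTE two0).
Qed.

(** A proper factorization would be into two factors of degree one. *)
Lemma cone_form_quadric (K : numFieldType) (Q : 'M[K]_3) lam :
  Q *m Q^T = 1%:M -> quadric (cone_form Q lam).
Proof.
move=> QQ; set q := cone_form Q lam.
have qE v : ev q (Q^T *m v) = cone_val lam v.
  by rewrite ev_cone_form mulmxA QQ mul1mx.
have q0 : q != 0.
  apply/eqP => q0; have := qE (delta_mx 1 0).
  rewrite q0 /ev meval0 /cone_val !mxE /=.
  rewrite mul0r mulr0 expr1n expr0n mulr0 !subr0 => /eqP.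
  by rewrite eq_sym oner_eq0.
have sq : mmeasure mdeg q = 3%N.
  have hq := cone_form_homog Q lam.
  by rewrite (mpolySpred mdeg q0) -(dhomog_uniq q0 hq (dhomog_msize hq)).
have nonunit (A : pol3 K) :
    A != 0 -> A \isn't a GRing.unit -> (1 < mmeasure mdeg A)%N.
  move=> A0; apply: contraNT; rewrite -leqNgt => /msize1_polyC eA.
  have a0 : mcoeff mnm0 A != 0.
    by apply: contraNneq A0 => a0; rewrite eA a0 raddf0.
  by rewrite eA rmorph_unit // unitfE.
split; first exact: cone_form_homog.
split=> // [|A B eAB].
  apply/negP => /(unit_ev 0); rewrite ev_cone_form mulmx0 /cone_val !mxE.
  by rewrite mul0r mulr0 expr0n mulr0 !subr0 eqxx.
have [AU|AU] := boolP (A \is a GRing.unit); first by left.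
have [BU|BU] := boolP (B \is a GRing.unit); first by right.
have A0 : A != 0 by apply: contraNneq q0 => A0; rewrite eAB A0 mul0r.
have B0 : B != 0 by apply: contraNneq q0 => B0; rewrite eAB B0 mulr0.
have := msizeM A0 B0; rewrite -eAB sq.
have [sA sB] := (nonunit A A0 AU, nonunit B B0 BU) => sAB.
have [|a [a0 eA]] := @affine_of_msize _ A.
  by move: sA sB sAB; set u := mmeasure _ A; set v := mmeasure _ B; lia.
have [|b [b0 eB]] := @affine_of_msize _ B.
  by move: sA sB sAB; set u := mmeasure _ A; set v := mmeasure _ B; lia.
exfalso; apply: (@cone_form_not_product K
   a0 ((Q *m a) 0 0) ((Q *m a) 1 0) ((Q *m a) 2%:R 0)
   b0 ((Q *m b) 0 0) ((Q *m b) 1 0) ((Q *m b) 2%:R 0) lam) => x y z.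
have linE l c : ev (linear_form l + mpolyC 3 c) (Q^T *m vec3 x y z) =
   c + ((Q *m l) 0 0 * x + (Q *m l) 1 0 * y + (Q *m l) 2%:R 0 * z).
  rewrite /ev mevalD mevalC -/(ev _ _) addrC; congr (c + _).
  have -> : ev (linear_form l) (Q^T *m vec3 x y z) =
      ((Q *m l)^T *m vec3 x y z) 0 0.
    rewrite trmx_mul -mulmxA ev_linear_form mxE.
    by apply: eq_bigr => i _; rewrite !mxE.
  by rewrite mxE sum3 !mxE.
have := qE (vec3 x y z); rewrite eAB evM {1}eA {1}eB !linE => ->.
by rewrite /cone_val !mxE.
Qed.

(** * Quadratic and linear divisors of invariant forms *)

Section Divisors.
Variables (K : numFieldType) (Q : 'M[K]_3).
Hypothesis QtQ : Q^T *m Q = 1%:M.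
Variables (G : pol3 K) (k : nat) (c : K) (r : seq K).
Hypothesis c0 : c != 0.
Hypothesis eG : G = c *: (coord Q 0 ^+ k * \prod_(l <- r) cone_form Q l).

Let QQt : Q *m Q^T = 1%:M. Proof. exact: mulmx1C. Qed.

(** On the curve [x = 1, y^2 - 2 x z = s], all the factors of [G] are
    constant, and none vanishes for a suitable [s]; then so are the divisors. *)
Lemma divisor_constant_on_parabola H :
  mdivides H G ->
  exists s d, forall y, ev H (Q^T *m vec3 1 y ((y ^+ 2 - s) / 2%:R)) = d.
Proof.
move=> [H' eH].
have [n rn] : exists n : nat, (\prod_(l <- r) ('X - l%:P)).[n%:R] != 0.
  apply: contrapT => no; have : \prod_(l <- r) ('X - l%:P) == 0.
    apply/eqP/poly_nat_ext => n; rewrite horner0.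
    by apply/eqP/negPn/negP => nr; apply: no; exists n.
  by rewrite (negbTE (monic_neq0 (monic_prod_XsubC _ _ _))).
pose cv : 'cV[{poly K}]_3 := map_mx polyC Q^T *m
  vec3 1 'X (('X ^+ 2 - n%:R%:P) * (2%:R^-1)%:P).
have evE A y :
    (along cv A).[y] = ev A (Q^T *m vec3 1 y ((y ^+ 2 - n%:R) / 2%:R)).
  rewrite horner_along; congr (ev A _); apply/matrixP => i j.
  rewrite ord1 !mxE horner_sum; apply: eq_bigr => i' _.
  rewrite !mxE hornerM hornerC.
  by congr (_ * _); move: i'; apply: ord3P; rewrite /= !hornerE.
have GE y : (along cv G).[y] = c * \prod_(l <- r) (n%:R - l).
  rewrite evE eG /ev mevalZ mevalM rmorphXn rmorph_prod /= -!/(ev _ _).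
  rewrite ev_coord mulmxA QQt mul1mx !mxE /= expr1n mul1r; congr (_ * _).
  apply: eq_bigr => l _; rewrite -/(ev _ _) ev_cone_form mulmxA QQt mul1mx.
  by rewrite /cone_val !mxE /=; field.
have [||d Hd] := @divisor_of_constant _ (along cv H) (along cv H')
    (c * \prod_(l <- r) (n%:R - l)).
- rewrite mulf_neq0 //; move: rn; rewrite horner_prod.
  by under eq_bigr do rewrite hornerXsubC.
- by apply: poly_nat_ext => m; rewrite -rmorphM -eH GE hornerC.
by exists n%:R, d => y; rewrite -evE Hd.
Qed.

Lemma quartic_vanishing (a0 a1 a2 a3 a4 : K) :
  (forall y, a0 + a1 * y + a2 * y ^+ 2 + a3 * y ^+ 3 + a4 * y ^+ 4 = 0) ->
  [/\ a0 = 0, a1 = 0, a2 = 0, a3 = 0 & a4 = 0].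
Proof.
move=> h; have p0 : Poly [:: a0; a1; a2; a3; a4] = 0.
  apply: poly_nat_ext => n; rewrite horner0 horner_Poly /=.
  by apply: etrans (h n%:R); ring.
by split; [have := coef_Poly [:: a0; a1; a2; a3; a4] 0
  | have := coef_Poly [:: a0; a1; a2; a3; a4] 1
  | have := coef_Poly [:: a0; a1; a2; a3; a4] 2
  | have := coef_Poly [:: a0; a1; a2; a3; a4] 3
  | have := coef_Poly [:: a0; a1; a2; a3; a4] 4]; rewrite p0 coef0.
Qed.

(** The functions [1], [y] and [z] are linearly independent on the parabola, so
    that a form that is constant there involves neither [y] nor [z]. *)
Lemma linear_divisor l :
  mdivides (linear_form l) G -> (Q *m l) 1 0 = 0 /\ (Q *m l) 2%:R 0 = 0.
Proof.
move=> /divisor_constant_on_parabola[s [d h]].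
pose u := Q *m l.
have linE x y z : ev (linear_form l) (Q^T *m vec3 x y z) =
    u 0 0 * x + u 1 0 * y + u 2%:R 0 * z.
  have -> : ev (linear_form l) (Q^T *m vec3 x y z) =
      (u^T *m vec3 x y z) 0 0.
    rewrite trmx_mul -mulmxA ev_linear_form mxE.
    by apply: eq_bigr => i _; rewrite !mxE.
  by rewrite mxE sum3 !mxE.
have [|_ u1 u2 _ _] := @quartic_vanishing
    (u 0 0 - u 2%:R 0 * s / 2%:R - d) (u 1 0) (u 2%:R 0 / 2%:R) 0 0.
  by move=> y; rewrite -(h y) linE; field.
split=> //; apply/eqP; move/eqP: u2; rewrite mulf_eq0 invr_eq0 pnatr_eq0.
by rewrite orbF.
Qed.

(** Along the parabola a quadratic form is a polynomial of degree four in [y];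
    if it is constant, only [x^2] and [y^2 - 2 x z] can occur in it. *)
Lemma quadric_divisor q :
  quadric q -> mdivides q G ->
  exists d lam, d != 0 /\ q = d *: cone_form Q lam.
Proof.
move=> [hq [q0 qU qirr]] /divisor_constant_on_parabola[s [d h]].
have [M [Ms Me]] := form_matrix_exists hq.
have [A eA] : exists A, A = Q *m M *m Q^T by exists (Q *m M *m Q^T).
have As : A^T = A by rewrite eA !trmx_mul trmxK Ms mulmxA.
have As' i j : A i j = A j i by rewrite -{1}As mxE.
have qE x y z : ev q (Q^T *m vec3 x y z) =
    A 0 0 * x ^+ 2 + A 1 1 * y ^+ 2 + A 2%:R 2%:R * z ^+ 2 +
    2%:R * (A 0 1 * (x * y) + A 0 2%:R * (x * z) + A 1 2%:R * (y * z)).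
  rewrite Me trmx_mul trmxK.
  have -> : (vec3 x y z)^T *m Q *m M *m (Q^T *m vec3 x y z) =
      (vec3 x y z)^T *m A *m vec3 x y z by rewrite eA !mulmxA.
  rewrite mxE sum3 !mxE !sum3 !mxE /= (As' 1 0) (As' 2%:R 0) (As' 2%:R 1).
  by ring.
have [|_ a1 a2 a3 a4] := @quartic_vanishing
    (A 0 0 + A 2%:R 2%:R * s ^+ 2 / 4%:R - A 0 2%:R * s - d)
    (2%:R * A 0 1 - A 1 2%:R * s)
    (A 1 1 - A 2%:R 2%:R * s / 2%:R + A 0 2%:R)
    (A 1 2%:R) (A 2%:R 2%:R / 4%:R).
  by move=> y; rewrite -(h y) qE; field.
have a22 : A 2%:R 2%:R = 0.
  by move/eqP: a4; rewrite mulf_eq0 invr_eq0 pnatr_eq0 orbF => /eqP.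
have a01 : A 0 1 = 0.
  by move/eqP: a1; rewrite a3 mul0r subr0 mulf_eq0 pnatr_eq0 => /eqP.
have a02 : A 0 2%:R = - A 1 1.
  by apply/eqP; rewrite -addr_eq0 addrC -a2 a22; apply/eqP; ring.
have qv p : ev q p =
    A 1 1 * ((Q *m p) 1 0 ^+ 2 - 2%:R * ((Q *m p) 0 0 * (Q *m p) 2%:R 0)) +
    A 0 0 * (Q *m p) 0 0 ^+ 2.
  have {1}-> : p = Q^T *m (Q *m p) by rewrite mulmxA QtQ mul1mx.
  by rewrite {1}(vec3_eta (Q *m p)) qE a22 a01 a02 a3; ring.
(* otherwise [q] is a multiple of [x^2], which is reducible *)
have A11 : A 1 1 != 0.
  apply/negP => /eqP A11.
  have eq : q = (A 0 0 *: coord Q 0) * coord Q 0.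
    apply: mpoly_nat_ext => x y z; move: (\col_i _) => p.
    by rewrite qv A11 evM /ev mevalZ -/(ev _ _) ev_coord; ring.
  have ev0 e : ev (e *: coord Q 0) 0 = 0.
    by rewrite /ev mevalZ -/(ev _ _) ev_coord mulmx0 mxE mulr0.
  have [/(unit_ev 0)|/(unit_ev 0)] := qirr _ _ eq; rewrite ?ev0 ?eqxx //.
  by rewrite -[coord Q 0]scale1r ev0 eqxx.
exists (A 1 1), (- A 0 0 / A 1 1); split=> //.
apply: mpoly_nat_ext => x y z; move: (\col_i _) => p.
by rewrite qv /ev mevalZ -/(ev _ _) ev_cone_form /cone_val; field.
Qed.

End Divisors.

(** * Coordinates adapted to the axis, and circular cones *)

Section Geometry.
Variables (R : realType) (T : rigid_motion R).
Local Notation Q := (Defs.rot T).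
Implicit Types (p u v w : 'cV[R]_3).

Lemma dotE u v : dot u v = u 0 0 * v 0 0 + u 1 0 * v 1 0 + u 2%:R 0 * v 2%:R 0.
Proof. by rewrite /dot mxE sum3 !mxE. Qed.

Lemma dot_rot u v : dot (Q *m u) (Q *m v) = dot u v.
Proof. by rewrite /dot trmx_mul -mulmxA (mulmxA _ Q) rot_orthogonal mul1mx. Qed.

Lemma dotC u v : dot u v = dot v u.
Proof. by rewrite !dotE; ring. Qed.

Lemma dotZl a u v : dot (a *: u) v = a * dot u v.
Proof. by rewrite !dotE !mxE; ring. Qed.

Lemma dotZr a u v : dot u (a *: v) = a * dot u v.
Proof. by rewrite !dotE !mxE; ring. Qed.

Lemma rotK p : Q^T *m (Q *m p) = p.
Proof. by rewrite mulmxA rot_orthogonal mul1mx. Qed.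

Lemma rotVK p : Q *m (Q^T *m p) = p.
Proof. by rewrite mulmxA rot_orthogonalr mul1mx. Qed.

Lemma rot_normal_dir : Q *m normal_dir T = delta_mx 0 0.
Proof.
rewrite /normal_dir mulmxA mulmxV ?mul1mx //.
by have [] := mulmx1_unit (rot_orthogonalr T).
Qed.

Lemma rot_axis (A : line R) : move T @` on_line A = @z_axis R ->
  exists2 t, t != 0 & Q *m line_dir A = t *: delta_mx 2%:R 0.
Proof.
move=> axis; have mv t : @z_axis R (move T (line_point A + t *: line_dir A)).
  by rewrite -axis; exists (line_point A + t *: line_dir A) => //; exists t.
have [[a0 a1] [b0 b1]] := (mv 0, mv 1).
have mvE t : move T (line_point A + t *: line_dir A) =
    move T (line_point A) + t *: (Q *m line_dir A).
  by rewrite /move mulmxDr -scalemxAr addrAC.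
have addE (u v : 'cV[R]_3) i : (u + v) i 0 = u i 0 + v i 0 by rewrite mxE.
move: a0 a1 b0 b1; rewrite !mvE scale0r addr0 scale1r !addE => a0 a1.
rewrite a0 a1 !add0r; set d := Q *m _ => d0 d1.
have ed : d = d 2%:R 0 *: delta_mx 2%:R 0.
  apply/matrixP => i j; rewrite ord1 [RHS]mxE [X in _ = _ * X]mxE; move: i.
  by apply: ord3P; rewrite /= ?mulr0 ?mulr1.
exists (d 2%:R 0) => //; apply/eqP => d2.
have /eqP[] := line_dir_neq0 A; rewrite -(rotK (line_dir A)) -/d ed d2.
by rewrite scale0r mulmx0.
Qed.

Lemma acos_half (g : R) : 0 <= g -> g ^+ 2 = 2%:R^-1 -> acos g = pi / 4%:R.
Proof.
move=> g0 g2; have p0 := pi_gt0 R.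
have -> : g = cos (pi / 4%:R).
  have c2 : cos (pi / 4%:R : R) ^+ 2 = 2%:R^-1.
    have := cos_mulr2n (pi / 4%:R : R).
    have -> : pi / 4%:R *+ 2 = pi / 2%:R :> R by rewrite mulr2n; field.
    rewrite cos_pihalf => /eqP; rewrite eq_sym subr_eq0 => /eqP e.
    apply: (mulIf (x := 2%:R)); rewrite ?pnatr_eq0 // mulVf ?pnatr_eq0 //.
    by rewrite mulr_natr.
  apply/eqP; rewrite -(@eqrXn2 _ 2) // ?g2 ?c2 //.
  by apply: cos_ge0_pihalf; apply/andP; split; lra.
by rewrite cosK // in_itv /=; apply/andP; split; lra.
Qed.

(** The points of the cone with [x = 1] form a parabola; comparing the two
    equations along it shows that the unit vector [e3] is a multiple of
    [(1, 0, 1)] in adapted coordinates. *)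
Lemma circular_cone_axis m (a : R) e1 e2 e3 :
  Defs.orthonormal e1 e2 e3 -> 0 < a ->
  [set p | cone_val m (Q *m p) = 0] = cone_eq e1 e2 e3 a a ->
  (Q *m e3) 2%:R 0 ^+ 2 = 2%:R^-1.
Proof.
move=> [[n1 n2 n3] [n12 n13 n23]] a0 eC.
pose P : 'M[R]_3 := \matrix_(i, j) ([:: e1; e2; e3]`_i) j 0.
have PPt : P *m P^T = 1%:M.
  apply/matrixP => i j; rewrite mxE sum3 !mxE -?dotE.
  move: i j; apply: ord3P; apply: ord3P;
    rewrite /= ?n1 ?n2 ?n3 ?n12 ?n13 ?n23 //; by rewrite dotC ?n12 ?n13 ?n23.
have parseval p : dot e1 p ^+ 2 + dot e2 p ^+ 2 + dot e3 p ^+ 2 = dot p p.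
  have -> : dot p p = dot (P *m p) (P *m p).
    by rewrite /dot trmx_mul -mulmxA (mulmxA _ P) (mulmx1C PPt) mul1mx.
  have PE i : (P *m p) i 0 = dot ([:: e1; e2; e3]`_i) p.
    by rewrite mxE sum3 !mxE -dotE.
  by rewrite [in RHS]dotE !PE !expr2.
pose f := Q *m e3; pose s := a ^- 2.
have s0 : 0 < s by rewrite invr_gt0 exprn_gt0.
have coneE x y z : cone_val m (vec3 x y z) = 0 ->
    s * (x ^+ 2 + y ^+ 2 + z ^+ 2) -
    (s + 1) * (f 0 0 * x + f 1 0 * y + f 2%:R 0 * z) ^+ 2 = 0.
  move=> h; have : cone_eq e1 e2 e3 a a (Q^T *m vec3 x y z).
    by rewrite -eC /= rotVK.
  rewrite /cone_eq /= !expr_div_n -/s -mulrDl.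
  have := parseval (Q^T *m vec3 x y z).
  have -> : dot (Q^T *m vec3 x y z) (Q^T *m vec3 x y z) =
      x ^+ 2 + y ^+ 2 + z ^+ 2 by rewrite -dot_rot rotVK dotE !mxE !expr2.
  have <- : dot e3 (Q^T *m vec3 x y z) =
      f 0 0 * x + f 1 0 * y + f 2%:R 0 * z.
    by rewrite -dot_rot rotVK dotE !mxE.
  by move=> <- e; rewrite mulrDr mulrC e; ring.
have [|_ _ y2 y3 y4] := @quartic_vanishing R
    (s * (1 + m ^+ 2 / 4%:R) - (s + 1) * (f 0 0 - f 2%:R 0 * m / 2%:R) ^+ 2)
    (- (s + 1) * 2%:R * f 1 0 * (f 0 0 - f 2%:R 0 * m / 2%:R))
    (s * (1 - m / 2%:R) -
     (s + 1) * (f 1 0 ^+ 2 + f 2%:R 0 * (f 0 0 - f 2%:R 0 * m / 2%:R)))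
    (- (s + 1) * (f 1 0 * f 2%:R 0))
    ((s - (s + 1) * f 2%:R 0 ^+ 2) / 4%:R).
  move=> y; rewrite -(coneE 1 y ((y ^+ 2 - m) / 2%:R)); first by field.
  by rewrite /cone_val !mxE /=; field.
have fn : f 0 0 ^+ 2 + f 1 0 ^+ 2 + f 2%:R 0 ^+ 2 = 1.
  by rewrite -n3 -(dot_rot e3) dotE -/f !expr2.
have s10 : s + 1 != 0 by lra.
have sE : s = (s + 1) * f 2%:R 0 ^+ 2 by lra.
have f20 : f 2%:R 0 != 0.
  by apply/eqP => f20; move: s0; rewrite sE f20 expr0n mulr0 ltxx.
have f10 : f 1 0 = 0.
  move/eqP: y3; rewrite !mulf_eq0 oppr_eq0 (negbTE s10) (negbTE f20).
  by rewrite orbF /= => /eqP.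
have f00 : f 0 0 = f 2%:R 0.
  apply: (mulIf f20); apply: (mulfI s10).
  move: y2; rewrite f10 => y2.
  apply/eqP; rewrite -subr_eq0; apply/eqP.
  rewrite -[RHS]oppr0 -y2 -sE.
  have -> : s * (1 - m / 2%:R) = s - (s + 1) * f 2%:R 0 ^+ 2 * m / 2%:R.
    by rewrite -sE; field.
  by ring.
by move: fn; rewrite -/f f00 f10 expr0n /= addr0 => fn; lra.
Qed.

End Geometry.

(** * Real cones *)

Section RealCones.
Variables (R : realType) (T : rigid_motion R) (m : R).
Local Notation Q := (Defs.rot T).
Implicit Types (p u v w : 'cV[R]_3).

Let C : set 'cV[R]_3 := [set p | cone_val m (Q *m p) = 0].

(** The symmetric matrix of [y^2 - 2 x z - m x^2] has the eigenvalue [1] and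
    two others of product [-1], here [mu] and [- mu^-1], with [mu > 0]; so it is
    an elliptic cone, and a circular one when [mu = 1], that is [m = 0]. *)
Lemma cone_classification : elliptic_cone C \/ exists w, circular_cone C w.
Proof.
have [mu mu0 em] : exists2 mu : R, 0 < mu & m = mu^-1 - mu.
  pose d := Num.sqrt (m ^+ 2 + 4%:R).
  have d2 : d ^+ 2 = m ^+ 2 + 4%:R by rewrite sqr_sqrtr //; nra.
  have d0 : 0 <= d by apply: sqrtr_ge0.
  have dm : 0 < d - m by nra.
  exists ((d - m) / 2%:R); first by lra.
  apply: (mulIf (x := (d - m) / 2%:R)); first by lra.
  by rewrite [RHS]mulrBl mulVf; [nra|lra].
pose n := Num.sqrt (1 + mu ^+ 2).
have n2 : n ^+ 2 = 1 + mu ^+ 2 by rewrite sqr_sqrtr //; nra.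
have n0 : n != 0.
  by apply/eqP => n0; move: n2; rewrite n0; nra.
pose r := Num.sqrt mu.
have r2 : r ^+ 2 = mu by rewrite sqr_sqrtr // ltW.
have r0 : 0 < r by rewrite sqrtr_gt0.
pose e1 := Q^T *m vec3 0 1 0.
pose e2 := Q^T *m vec3 (mu / n) 0 (- n^-1).
pose e3 := Q^T *m vec3 n^-1 0 (mu / n).
have dotQ u v : dot (Q^T *m u) (Q^T *m v) = dot u v.
  by rewrite -(dot_rot T) !rotVK.
have dotQ' u v : dot (Q^T *m u) v = dot u (Q *m v).
  by rewrite -(dot_rot T) rotVK.
have nn : (1 + mu ^+ 2) / n ^+ 2 = 1 by rewrite -n2 divff // expf_neq0.
have on : Defs.orthonormal e1 e2 e3.
  by split; split; rewrite dotQ dotE !mxE /=;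
    first [by ring | by field | by rewrite -[RHS]nn; field].
have key x y z : (y * r) ^+ 2 + ((mu / n * x - n^-1 * z) * mu) ^+ 2 -
    (n^-1 * x + mu / n * z) ^+ 2 =
    mu * (y ^+ 2 - 2%:R * (x * z) - m * x ^+ 2).
  rewrite exprMn r2.
  transitivity (mu * y ^+ 2 + (1 + mu ^+ 2) / n ^+ 2 *
      (mu * (- 2%:R * (x * z) - (mu^-1 - mu) * x ^+ 2))).
    by field; rewrite n0 gt_eqF.
  by rewrite nn em; field; rewrite gt_eqF.
have eC b : b = mu^-1 -> C = cone_eq e1 e2 e3 r^-1 b.
  move=> ->; have CE p : C p = (mu * cone_val m (Q *m p) = 0).
    apply/propext; rewrite /C /=; split=> [->|/eqP]; first by rewrite mulr0.
    by rewrite mulf_eq0 gt_eqF //= => /eqP.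
  rewrite predeqE => p; rewrite CE /cone_eq /= !dotQ' (vec3_eta (Q *m p)).
  rewrite !dotE /cone_val !mxE /= -key !invrK.
  rewrite !(mul0r, mul1r, add0r, addr0) mulNr.
  split=> [/eqP|->]; last by rewrite subrr.
  by rewrite subr_eq0 => /eqP.
have mui : 0 < mu^-1 by rewrite invr_gt0.
have ri : 0 < r^-1 by rewrite invr_gt0.
have [mu1|mu1] := eqVneq mu 1.
  have r1 : r = 1.
    by apply: (pexpIrn (n := 2)); rewrite ?nnegrE ?ltW // r2 mu1 expr1n.
  right; exists e3, e1, e2, e3, 1; split=> //.
  - by rewrite (eC 1) ?r1 ?mu1 ?invr1.
  - by exists 1; rewrite ?oner_eq0 ?scale1r.
left; exists e1, e2, e3, r^-1, mu^-1; split=> //; last exact: eC.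
apply/eqP => /invr_inj rmu; case/eqP: mu1.
by apply: (mulIf (x := mu)); rewrite ?gt_eqF // mul1r -{1 2}rmu -expr2.
Qed.

Variable A : line R.
Hypothesis axisA : move T @` on_line A = @z_axis R.

(** The half turn about the [y]-axis changes the signs of [x] and [z] together,
    which fixes [y], [x z] and [x^2]. *)
Lemma cone_symmetry_axis : exists w,
  [/\ symmetry_axis C w, dot w (line_dir A) = 0 & dot w (normal_dir T) = 0].
Proof.
pose w : 'cV[R]_3 := Q^T *m delta_mx 1 0.
have w0 : dot w w = 1.
  by rewrite -(dot_rot T) !rotVK dotE !mxE /= mulr0 mulr1 add0r addr0.
have [t t0 dE] := rot_axis axisA.
exists w; split.
- split.
    apply/eqP => e; move/eqP: w0; rewrite e dotE !mxE !mulr0 !addr0.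
    by rewrite eq_sym oner_eq0.
  have hE p : Q *m half_turn w p =
      vec3 (- (Q *m p) 0 0) ((Q *m p) 1 0) (- (Q *m p) 2%:R 0).
    rewrite /half_turn mulmxBr -scalemxAr rotVK w0 divr1 -(dot_rot T) rotVK.
    rewrite dotE; apply/matrixP => i j; rewrite ord1 [LHS]mxE [in RHS]mxE.
    by move: i; apply: ord3P; rewrite !mxE /=; ring.
  have hC p : C p -> C (half_turn w p).
    by rewrite /C /= hE /cone_val !mxE /= => e; rewrite -[RHS]e; ring.
  apply/seteqP; split=> [p [q Cq <-]|p Cp]; first exact: hC.
  exists (half_turn w p); first exact: hC.
  rewrite -[LHS](rotK T) -[RHS](rotK T); congr (_ *m _).
  rewrite hE hE [RHS]vec3_eta; congr vec3; rewrite !mxE /= ?opprK //.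
- by rewrite -(dot_rot T) rotVK dE dotE !mxE /=; ring.
by rewrite -(dot_rot T) rotVK rot_normal_dir dotE !mxE /=; ring.
Qed.

Lemma circular_cone_angle w :
  circular_cone C w -> line_angle w (line_dir A) = pi / 4%:R.
Proof.
move=> [e1 [e2 [e3 [a [on a0 eC [t t0 ->]]]]]].
have g2 := circular_cone_axis on a0 eC.
have [tau tau0 dE] := rot_axis axisA.
apply: acos_half; first by rewrite mulr_ge0 ?invr_ge0 ?mulr_ge0 ?sqrtr_ge0.
have [[_ _ n3] _] := on.
rewrite -(dot_rot T) dE /enorm !dotZl !dotZr n3 -(dot_rot T (line_dir A)) dE.
rewrite dotZl dotZr expr_div_n exprMn !sqr_sqrtr; last 2 first.
- by rewrite !dotE !mxE /=; nra.
- by rewrite mulr1 -expr2 sqr_ge0.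
have d2 u : dot u (delta_mx 2%:R 0) = u 2%:R 0 by rewrite dotE !mxE /=; ring.
rewrite real_normK ?num_real // -g2 -scalemxAr dotZl !d2.
have -> : (delta_mx 2%:R 0 : 'cV[R]_3) 2%:R 0 = 1 by rewrite mxE.
by move: ((Q *m e3) 2%:R 0) => g; field; rewrite t0 tau0.
Qed.

End RealCones.

(** * Non-real cones *)

Section ComplexCones.
Variables (R : realType) (T : rigid_motion R).
Local Notation C := R[i].
Local Notation toC := (real_complex R).
Local Notation Q := (Defs.rot T).
Local Notation cQ := (map_mx toC Q).

Lemma crot_orthogonal : cQ^T *m cQ = 1%:M.
Proof.
by rewrite matrix.map_trmx -map_mxM rot_orthogonal map_scalar_mx rmorph1.
Qed.

Lemma crot_orthogonalr : cQ *m cQ^T = 1%:M.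
Proof. exact: mulmx1C crot_orthogonal. Qed.

Lemma crot_cvec (p : 'cV[R]_3) : cQ *m cvec p = cvec (Q *m p).
Proof. by rewrite /cvec map_mxM. Qed.

(** The values at two real points, with coordinates [(0, 1, 0)] and
    [(1, 0, 0)], give [d] and [lam] up to the common factor [c]. *)
Lemma real_cone_form (q0 : pol3 R) (c d lam : C) :
  d != 0 -> c *: complexify q0 = d *: cone_form cQ lam ->
  exists m e, e != 0 /\ forall p, ev q0 p = e * cone_val m (Q *m p).
Proof.
move=> d0 eq.
have qE p : c * toC (ev q0 p) = d * cone_val lam (cvec (Q *m p)).
  have := congr1 (fun G => ev G (cvec p)) eq.
  by rewrite /ev !mevalZ -!/(ev _ _) ev_complexify ev_cone_form crot_cvec.
set e := ev q0 (Q^T *m delta_mx 1 0); set f := ev q0 (Q^T *m delta_mx 0 0).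
have eE : c * toC e = d.
  by rewrite qE rotVK /cone_val !mxE /= !rmorph0 rmorph1; ring.
have fE : c * toC f = - d * lam.
  by rewrite qE rotVK /cone_val !mxE /= !rmorph0 rmorph1; ring.
have c0 : c != 0 by apply: contraNneq d0 => c0; rewrite -eE c0 mul0r.
have e0 : e != 0 by apply: contraNneq d0 => e0; rewrite -eE e0 rmorph0 mulr0.
have lamE : lam = toC (- f / e).
  apply: (mulfI d0); rewrite rmorphM rmorphN fmorphV /=.
  rewrite -[d * lam]opprK -mulNr -fE -{1}eE; field.
  by rewrite fmorph_eq0.
exists (- f / e), e; split=> // p.
have := qE p; rewrite -eE -mulrA => /(mulfI c0).
rewrite lamE /cone_val !mxE => h.
apply: (fmorph_inj (real_complex R)); rewrite /= h.
by rewrite !(rmorphM, rmorphB, rmorph_nat, rmorphXn).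
Qed.

Definition cone_mx (lam : C) : 'M[C]_3 :=
  \matrix_(i < 3, j < 3)
    nth 0 (nth [::] [:: [:: - lam; 0; -1]; [:: 0; 1; 0]; [:: -1; 0; 0]] i) j.

Lemma cone_mx_sym lam : (cone_mx lam)^T = cone_mx lam.
Proof.
by apply/matrixP => i j; rewrite !mxE; move: i j; apply: ord3P; apply: ord3P.
Qed.

Lemma cone_mxE lam x y z :
  cone_mx lam *m vec3 x y z = vec3 (- lam * x - z) y (- x).
Proof.
apply/matrixP => i j; rewrite ord1 mxE sum3 !mxE; move: i.
by apply: ord3P; rewrite /=; ring.
Qed.

Variables (A : line R) (q : pol3 C) (d lam : C).
Hypothesis axisA : move T @` on_line A = @z_axis R.
Hypothesis d0 : d != 0.
Hypothesis qE : q = d *: cone_form cQ lam.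
Hypothesis q_nonreal : ~ real_up_to_constant q.

Let lam_nonreal m : lam != toC m.
Proof.
apply/eqP => lamE; apply: q_nonreal; exists (cone_form Q m), d; split=> //.
by rewrite complexify_cone_form -lamE.
Qed.

(** The matrix has the eigenvalue [1], with eigenvectors along the [y]-axis,
    and the two roots of [t^2 + lam t - 1]; a real root [t] would give the real
    value [(1 - t^2) / t] to [lam]. *)
Lemma nonreal_cone_eigen : exists (c : C) (M : 'M[C]_3) (lam : R),
  [/\ c != 0, form_matrix (c *: q) M,
      eigenvalue M (toC lam),
      forall mu : R, eigenvalue M (toC mu) -> mu = lam &
      forall v : 'cV[C]_3, v != 0 ->
        M *m v = toC lam *: v ->
        (v^T *m cvec (line_dir A)) 0 0 = 0 /\
        (v^T *m cvec (normal_dir T)) 0 0 = 0].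
Proof.
pose M := cQ^T *m cone_mx lam *m cQ.
have Ms : M^T = M by rewrite /M !trmx_mul trmxK cone_mx_sym mulmxA.
have Mv (v : 'cV[C]_3) a :
    M *m v = a *: v -> cone_mx lam *m (cQ *m v) = a *: (cQ *m v).
  move=> /(congr1 (mulmx cQ)); rewrite /M !mulmxA crot_orthogonalr mul1mx.
  by rewrite -scalemxAr -!mulmxA.
have vec3Z (a x y z : C) : a *: vec3 x y z = vec3 (a * x) (a * y) (a * z).
  by apply/matrixP => i j; rewrite ord1 !mxE; move: i; apply: ord3P.
have eigenE (v : 'cV[C]_3) a : M *m v = a *: v ->
    let u := cQ *m v in
    [/\ - lam * u 0 0 - u 2%:R 0 = a * u 0 0, u 1 0 = a * u 1 0 &
        - u 0 0 = a * u 2%:R 0].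
  move=> /Mv; set u := cQ *m v.
  rewrite {1 2}(vec3_eta u) cone_mxE vec3Z => /matrixP e.
  by split; [move: (e 0 0)|move: (e 1 0)|move: (e 2%:R 0)];
    rewrite ![vec3 _ _ _ _ _]mxE.
exists d^-1, M, 1; split.
- by rewrite invr_eq0.
- split=> // p; rewrite qE scalerA mulVf // scale1r ev_cone_form.
  rewrite /M !mulmxA -(mulmxA _ cQ p) -trmx_mul -mulmxA.
  move: (cQ *m p) => u; rewrite (vec3_eta u) cone_mxE mxE sum3 !mxE.
  by rewrite /cone_val !mxE /=; ring.
- apply/eigenvalueP; exists (delta_mx 0 1 *m cQ).
    rewrite /M !mulmxA -(mulmxA (delta_mx 0 1)) crot_orthogonalr mulmx1.
    rewrite rmorph1 scale1r; congr (_ *m _); apply/matrixP => i j.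
    by rewrite mxE sum3 !mxE ord1; move: j; apply: ord3P; rewrite /=; ring.
  apply/eqP => /(congr1 (mulmxr cQ^T)) /=.
  rewrite -mulmxA crot_orthogonalr mulmx1 mul0mx => /matrixP/(_ 0 1).
  by rewrite !mxE /= => /eqP; rewrite oner_eq0.
- move=> mu /eigenvalueP[v vM v0].
  have {vM} : M *m v^T = toC mu *: v^T by rewrite -{1}Ms -trmx_mul vM linearZ.
  move=> /eigenE; set u := cQ *m v^T => -[] /=; set a := toC mu => e0 e1 e2.
  have [//|mu1] := eqVneq mu 1; exfalso.
  have u1 : u 1 0 = 0.
    have : (1 - a) * u 1 0 = 0 by rewrite mulrBl mul1r -e1 subrr.
    move/eqP; rewrite mulf_eq0 subr_eq0 eq_sym => /orP[|/eqP//].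
    by rewrite /a -(rmorph1 toC) (inj_eq (fmorph_inj _)) (negbTE mu1).
  have u0 : u 0 0 = - a * u 2%:R 0 by rewrite mulNr -e2 opprK.
  have u2 : u 2%:R 0 != 0.
    apply/eqP => u2; case/eqP: v0; apply: trmx_inj.
    rewrite -[v^T]mul1mx -crot_orthogonal -mulmxA -/u (vec3_eta u).
    rewrite u0 u1 u2 mulr0.
    rewrite trmx0 -[RHS](mulmx0 _ cQ^T); congr (_ *m _).
    by apply/matrixP => i j; rewrite !mxE; move: i; apply: ord3P.
  have lamE : lam * a = 1 - a ^+ 2.
    apply: (mulIf u2).
    transitivity (- lam * (- a * u 2%:R 0) - u 2%:R 0 + u 2%:R 0).
      by ring.
    by rewrite -u0 e0 u0; ring.
  have a0 : a != 0.
    apply/eqP => a0; move/eqP: lamE.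
    by rewrite a0 mulr0 expr0n subr0 eq_sym oner_eq0.
  have /eqP[] := lam_nonreal ((1 - mu ^+ 2) / mu).
  rewrite rmorphM rmorphB rmorphXn rmorph1 fmorphV /= -/a.
  by apply: (mulIf a0); rewrite mulfVK.
move=> v v0; rewrite rmorph1 => /eigenE; set u := cQ *m v => -[] /=.
rewrite !mul1r => e0 _ e2.
have u0 : u 0 0 = 0.
  have : lam * u 0 0 = 0.
    transitivity (- (- lam * u 0 0 - u 2%:R 0) - u 2%:R 0); first by ring.
    by rewrite e0 -e2; ring.
  move/eqP; rewrite mulf_eq0 => /orP[/eqP lam0|/eqP//].
  by have := lam_nonreal 0; rewrite lam0 rmorph0 eqxx.
have u2 : u 2%:R 0 = 0 by rewrite -e2 u0 oppr0.
have dotu w : (v^T *m cvec w) 0 0 = u 1 0 * toC ((Q *m w) 1 0).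
  have -> : v^T *m cvec w = u^T *m cvec (Q *m w).
    rewrite -crot_cvec trmx_mul -mulmxA (mulmxA _ cQ) crot_orthogonal.
    by rewrite mul1mx.
  rewrite mxE sum3 [u^T _ _]mxE [u^T _ 1]mxE [u^T _ 2%:R]mxE u0 u2.
  by rewrite [cvec _ 1 _]mxE; ring.
have [t _ dE] := rot_axis axisA.
by rewrite !dotu dE rot_normal_dir !mxE /= mulr0 rmorph0 mulr0.
Qed.

End ComplexCones.

(** * Parallel curves and plane sections *)

Lemma roots_list (K : idomainType) (p : {poly K}) :
  p != 0 -> exists s : seq K, forall x, (x \in s) = root p x.
Proof.
have [n] := ubnP (size p); elim: n p => // n IHn p /ltnSE sp p0.
have [[x rx]|norx] := EM (exists x, root p x); last first.
  by exists [::] => x; apply/esym/negP => rx; apply: norx; exists x.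
have /factor_theorem[q eq] := rx.
have q0 : q != 0 by apply: contraNneq p0 => q0; rewrite eq q0 mul0r.
have [|s sE] := IHn q _ q0.
  by move: sp; rewrite eq size_Mmonic ?monicXsubC // size_XsubC addn2.
by exists (x :: s) => y; rewrite inE sE eq rootM root_XsubC orbC.
Qed.

Lemma hessian_affine (R : realType) (F : pol3 R) p :
  (mmeasure mdeg F <= 2)%N -> hessian F p = 0.
Proof.
move=> /affine_of_msize[l [a ->]]; apply/matrixP => i j; rewrite !mxE.
have mX k k' : mderiv k (mpolyX R (mnm1 k')) = mpolyC 3 (k == k')%:R.
  rewrite mderivX mnm1E eq_sym.
  case: eqP => [->|_]; last by rewrite scale0r raddf0.
  rewrite scale1r (_ : mnm_sub _ _ = mnm0) ?mpolyX0 //.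
  by apply/mnmP => k2; rewrite mnmBE mnm0E subnn.
rewrite mderivD mderivC addr0 /linear_form (raddf_sum (mderiv i)).
rewrite (raddf_sum (mderiv j)) big1 ?/ev ?meval0 // => k _.
by rewrite /= mderivZ mX mderivZ mderivC scaler0.
Qed.

Lemma adj0 (R : comNzRingType) : \adj (0 : 'M[R]_3) = 0.
Proof.
apply/matrixP => i j; rewrite !mxE /cofactor.
by rewrite [row' _ _](_ : _ = 0) ?linear0 // det0 ?mulr0.
Qed.

Section ParallelCurves.
Variables (R : realType) (T : rigid_motion R) (A : line R) (F : pol3 R).
Local Notation Q := (Defs.rot T).
Implicit Types (p u v w : 'cV[R]_3).
Hypothesis axisA : move T @` on_line A = @z_axis R.

Lemma move_parallel_curve p r :
  parallel_curve T p r <->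
  exists a, move T r = vec3 (move T p 0 0) (a * move T p 0 0 + move T p 1 0)
    (a ^+ 2 / 2%:R * move T p 0 0 + a * move T p 1 0 + move T p 2%:R 0).
Proof. by split=> -[a e]; exists a; rewrite e -par_mxE -vec3_eta. Qed.

(** On the orbit, [x] and [y^2 - 2 x z] are constant and [y] is arbitrary. *)
Lemma parallel_curve_parabola p : move T p 0 0 != 0 ->
  parabola (parallel_curve T p) (line_dir A).
Proof.
set m := move T p => x0; have [tau tau0 dE] := rot_axis axisA.
pose x := m 0 0; pose y := m 1 0; pose z := m 2%:R 0.
exists (unmove T (vec3 x 0 (z - y ^+ 2 / (2%:R * x)))), (Q^T *m delta_mx 1 0),
  (Q^T *m delta_mx 2%:R 0), (2%:R * x)^-1; split.
- by split; rewrite -(dot_rot T) !rotVK dotE !mxE /=; ring.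
- exists tau^-1; first by rewrite invr_eq0.
  by rewrite -[line_dir A](rotK T) dE scalemxAr scalerA mulVf // scale1r.
- by rewrite invr_eq0 mulf_neq0 ?pnatr_eq0.
have ptE t : move T (unmove T (vec3 x 0 (z - y ^+ 2 / (2%:R * x))) +
      t *: (Q^T *m delta_mx 1 0) +
      ((2%:R * x)^-1 * t ^+ 2) *: (Q^T *m delta_mx 2%:R 0)) =
    vec3 x t (z - y ^+ 2 / (2%:R * x) + t ^+ 2 / (2%:R * x)).
  have moveD u v : move T (u + v) = move T u + Q *m v.
    by rewrite /move mulmxDr addrAC.
  rewrite !moveD unmoveK -!scalemxAr !rotVK.
  apply/matrixP => i j; rewrite ord1 !mxE.
  by move: i; apply: ord3P; rewrite /=; field.
rewrite predeqE => r; rewrite move_parallel_curve -/m -/x -/y -/z.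
split=> -[t e].
  exists (t * x + y); apply: (can_inj (moveK T)); rewrite e ptE.
  by congr vec3; field.
exists ((t - y) / x); rewrite e ptE; congr vec3; by field.
Qed.

Hypothesis Firr : irreducible_pol F.
Hypothesis Ffat : fat_projection (zeros F) 2.
Hypothesis Fcurv : curvature_not_identically_zero F.
Hypothesis Finv : forall a p, ev F (par_act T a p) = ev F p.

Definition first_coord : pol3 R := coord Q 0 + mpolyC 3 (trans T 0 0).

Lemma ev_first_coord p : ev first_coord p = move T p 0 0.
Proof.
by rewrite /first_coord /ev mevalD mevalC -/(ev _ _) ev_coord /move !mxE.
Qed.

(** Otherwise [F] divides a polynomial of degree one, its Hessian is zero, and
    so is the curvature. *)
Lemma zeros_not_planar : ~ (zeros F `<=` zeros first_coord).
Proof.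
move=> /(vanishing_divides Firr Ffat)[H eH].
have [F0 _ _] := Firr.
have G0 : first_coord != 0.
  apply/eqP => G0; have := ev_first_coord (unmove T (delta_mx 0 0)).
  by rewrite G0 /ev meval0 unmoveK mxE /= => /eqP; rewrite eq_sym oner_eq0.
have H0 : H != 0 by apply: contraNneq G0 => H0; rewrite eH H0 mulr0.
have sG : (mmeasure mdeg first_coord <= 2)%N.
  apply: leq_trans (mmeasureD_le _ _ _) _; rewrite geq_max mmeasureC.
  apply/andP; split; last by case: (_ != _).
  apply: leq_trans (mmeasure_sum _ _ _ _) _.
  apply/bigmax_leqP_seq => i _ _; apply: leq_trans (mmeasureZ_le _ _ _) _.
  by rewrite mmeasureX /= mdeg1.
have sF : (mmeasure mdeg F <= 2)%N.
  have := msizeM F0 H0; rewrite -eH => e.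
  have := mpolySpred mdeg H0; move: sG e; rewrite /=.
  set f := mmeasure _ F; set h := mmeasure _ H; set g := mmeasure _ first_coord.
  by lia.
have [p [_ _]] := Fcurv; rewrite /gaussian_curvature (hessian_affine _ sF).
by rewrite adj0 mulmx0 mul0mx mxE mul0r eqxx.
Qed.

Lemma par_act_plane p : move T p 0 0 != 0 ->
  par_act T (- move T p 1 0 / move T p 0 0) p =
  unmove T (vec3 (move T p 0 0) 0
     (move T p 2%:R 0 - move T p 1 0 ^+ 2 / (2%:R * move T p 0 0))).
Proof.
move=> x0; rewrite /par_act [X in _ *m X]vec3_eta par_mxE.
by congr (unmove T (vec3 _ _ _)); field.
Qed.

Lemma exists_restriction (c : 'cV[{poly R}]_3) :
  exists f : {poly R}, forall t, f.[t] = ev F (unmove T (\col_i (c i 0).[t])).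
Proof.
exists (along (map_mx polyC Q^T *m (c - map_mx polyC (trans T))) F) => t.
rewrite horner_along; congr (ev F _); apply/matrixP => i j.
rewrite ord1 /unmove !mxE horner_sum; apply: eq_bigr => k _.
by rewrite !mxE hornerM hornerD hornerN !hornerC.
Qed.

(** The section of the surface by a plane [x = x1], with [x1 != 0], is the
    union of the orbits of its points on the line [y = 0]. They are finitely
    many unless [F] vanishes on the whole plane, which happens for finitely
    many [x1], as the restriction of [F] to some line parallel to the [x]-axis
    is not zero. *)
Lemma plane_sections : exists bad : seq R, forall x, x \notin bad ->
  exists ps : seq 'cV[R]_3,
    (forall p, p \in ps ->
       zeros F p /\ parabola (parallel_curve T p) (line_dir A)) /\
    zeros F `&` [set r | move T r 0 0 = x] =
      \bigcup_(p in [set` ps]) parallel_curve T p.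
Proof.
have [q Fq] := exists_nonzero Firr.
pose m := move T q.
have [g gE] := exists_restriction (vec3 'X (m 1 0)%:P (m 2%:R 0)%:P).
have gv t : g.[t] = ev F (unmove T (vec3 t (m 1 0) (m 2%:R 0))).
  rewrite gE; congr (ev F (unmove T _)).
  apply/matrixP => i j; rewrite ord1 !mxE.
  by move: i; apply: ord3P; rewrite /= !hornerE.
have g0 : g != 0.
  apply: contraNneq Fq => g0.
  by rewrite -(moveK T q) (vec3_eta (move T q)) -gv g0 horner0.
have [s sE] := roots_list g0.
exists (0 :: s) => x; rewrite inE negb_or sE => /andP[x0 gx].
have [f fE] := exists_restriction (vec3 x%:P 0 'X).
have fv z : f.[z] = ev F (unmove T (vec3 x 0 z)).
  rewrite fE; congr (ev F (unmove T _)).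
  apply/matrixP => i j; rewrite ord1 !mxE.
  by move: i; apply: ord3P; rewrite /= !hornerE.
have f0 : f != 0.
  apply: contraNneq gx => f0; apply/eqP; rewrite gv.
  rewrite -(Finv (- m 1 0 / x)).
  have := @par_act_plane (unmove T (vec3 x (m 1 0) (m 2%:R 0))).
  rewrite unmoveK !mxE /= => -> //.
  by rewrite -fv f0 horner0.
have [zs zsE] := roots_list f0.
exists [seq unmove T (vec3 x 0 z) | z <- zs]; split=> [p /mapP[z]|].
  rewrite zsE => /rootP fz ->; split; first by rewrite /zeros /= -fv.
  by apply: parallel_curve_parabola; rewrite unmoveK mxE.
apply/seteqP; split=> [r [Fr /= rx]|r [p /= /mapP[z]]].
  have r0 : move T r 0 0 != 0 by rewrite rx.
  set z := move T r 2%:R 0 - move T r 1 0 ^+ 2 / (2%:R * move T r 0 0).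
  exists (unmove T (vec3 x 0 z)) => /=.
    apply: map_f; rewrite zsE; apply/rootP.
    by rewrite fv -rx -par_act_plane // Finv.
  apply/move_parallel_curve; rewrite unmoveK !mxE /=; exists (move T r 1 0 / x).
  by rewrite {1}(vec3_eta (move T r)) /z rx; congr vec3; field.
rewrite zsE => /rootP fz -> [a e]; split=> /=.
  have : r = par_act T a (unmove T (vec3 x 0 z)) by rewrite /par_act -e moveK.
  by move=> ->; rewrite /zeros /= Finv -fv.
by rewrite e unmoveK par_mxE mxE.
Qed.

End ParallelCurves.

(** * The form of highest degree *)

Theorem theorem9 (R : realType) (F : pol3 R) (A : line R) (T : rigid_motion R) :
  irreducible_pol F ->
  has_dim (zeros F) 2 ->
  curvature_not_identically_zero F ->
  par_rotation_surface (zeros F) A T ->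
  let FN := complexify (top_form F) in
  let d := line_dir A in
  let L := normal_dir T in
  [/\ (exists (l : 'cV[R]_3) (k : nat) (c : R[i]) (qs : seq (pol3 R[i])),
         [/\ l != 0, c != 0, forall q, q \in qs -> quadric q &
             FN = c *: (complexify (linear_form l) ^+ k * \prod_(q <- qs) q)]),
      (forall (q : pol3 R[i]) (q0 : pol3 R) (c : R[i]),
         quadric q -> mdivides q FN -> c != 0 -> q = c *: complexify q0 ->
         let C := zeros q0 in
         [/\ elliptic_cone C \/ exists w, circular_cone C w,
             elliptic_cone C ->
               exists w, [/\ symmetry_axis C w, dot w d = 0 & dot w L = 0] &
             forall w, circular_cone C w -> line_angle w d = pi / 4%:R]),
      (forall q : pol3 R[i],
         quadric q -> mdivides q FN -> ~ real_up_to_constant q ->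
         exists (c : R[i]) (M : 'M[R[i]]_3) (lam : R),
           [/\ c != 0, form_matrix (c *: q) M,
               eigenvalue M (real_complex R lam),
               forall mu : R, eigenvalue M (real_complex R mu) -> mu = lam &
               forall v : 'cV[R[i]]_3, v != 0 ->
                 M *m v = real_complex R lam *: v ->
                 (v^T *m cvec d) 0 0 = 0 /\ (v^T *m cvec L) 0 0 = 0]) &
      (forall l : 'cV[R]_3,
         l != 0 -> mdivides (complexify (linear_form l)) FN ->
         [/\ dot l d = 0,
             generically (zeros F) (fun p =>
               parallel_curve T p `<=` [set r | dot l r = dot l p] /\
               parabola (parallel_curve T p) d) &
             exists bad : seq R, forall h : R, h \notin bad ->
               exists ps : seq 'cV[R]_3,
                 (forall p, p \in ps ->
                    zeros F p /\ parabola (parallel_curve T p) d) /\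
                 zeros F `&` [set r | dot l r = h] =
                   \bigcup_(p in [set` ps]) parallel_curve T p])].
Proof.
move=> Firr [Ffat _] Fcurv [axisA Fset] FN d L.
have Finv := par_act_invariant Firr Ffat Fset.
have G0 : top_form F != 0 by apply: top_form_neq0; case: Firr.
have [k [c [r [c0 eFN]]]] := invariant_form_factors
  (pihomogP mdeg _ F : top_form F \is _) (top_form_invariant Firr Ffat Fset) G0.
rewrite -/FN in eFN.
have cQ := crot_orthogonal T; have cQr := crot_orthogonalr T.
have quadE q : quadric q -> mdivides q FN -> exists e lam, e != 0 /\
    q = e *: cone_form (map_mx (real_complex R) (Defs.rot T)) lam.
  exact: (quadric_divisor cQ c0 eFN).
split.
(* the plane [x = 0] in adapted coordinates, and the invariant quadrics *)
- exists (row 0 (Defs.rot T))^T, k, c,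
    [seq cone_form (map_mx (real_complex R) (Defs.rot T)) lam | lam <- r].
  split=> //.
  + apply/eqP => /(congr1 trmx); rewrite trmxK trmx0.
    move=> /(congr1 (mulmx^~ (Defs.rot T)^T)).
    rewrite -row_mul rot_orthogonalr mul0mx => /matrixP/(_ 0 0).
    by rewrite !mxE => /eqP; rewrite oner_eq0.
  + by move=> q /mapP[lam _ ->]; apply: cone_form_quadric.
  + by rewrite -/(coord _ _) complexify_coord big_map.
- move=> q q0 c' qq qdiv c'0 eq C.
  have [e [lam [e0 eq']]] := quadE _ qq qdiv.
  have [m [b [b0 q0E]]] := real_cone_form e0 (etrans (esym eq) eq').
  have -> : C = [set p | cone_val m (Defs.rot T *m p) = 0].
    rewrite predeqE => p; rewrite /C /zeros /= q0E.
    split=> [/eqP|->]; last by rewrite mulr0.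
    by rewrite mulf_eq0 (negbTE b0) => /eqP.
  split; first exact: cone_classification.
    by move=> _; exact: cone_symmetry_axis axisA.
  by move=> w; exact: circular_cone_angle axisA w.
- move=> q qq qdiv qnr; have [e [lam [e0 eq]]] := quadE _ qq qdiv.
  exact: (nonreal_cone_eigen axisA e0 eq qnr).
move=> l l0; rewrite complexify_linear_form.
move=> /(linear_divisor cQ c0 eFN).
rewrite crot_cvec [cvec _ 1 _]mxE [cvec _ 2%:R _]mxE => -[/eqP Ql1 /eqP Ql2].
move: Ql1 Ql2; rewrite !fmorph_eq0 => /eqP Ql1 /eqP Ql2.
set x := (Defs.rot T *m l) 0 0.
have dotl p : dot l p = x * (Defs.rot T *m p) 0 0.
  by rewrite -(dot_rot T) dotE Ql1 Ql2 -/x; ring.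
have x0 : x != 0.
  apply: contraNneq l0 => x0; rewrite -(rotK T l) (vec3_eta (Defs.rot T *m l)).
  rewrite -/x x0 Ql1 Ql2 -(mulmx0 _ (Defs.rot T)^T); apply/eqP; congr (_ *m _).
  by apply/matrixP => i j; rewrite !mxE; move: i; apply: ord3P.
have dotm p : dot l p = x * (move T p 0 0 - trans T 0 0).
  by rewrite dotl /move [(_ + _ : 'cV_3) 0 0]mxE addrK.
split.
- by have [t _ dE] := rot_axis axisA; rewrite dotl /d dE !mxE /=; ring.
- exists (first_coord T); first exact: zeros_not_planar.
  move=> p Fp; rewrite ev_first_coord => p0; split.
    move=> s /move_parallel_curve[a e] /=.
    by rewrite !dotm e mxE.
  exact: parallel_curve_parabola.
have [bad badP] := plane_sections axisA Firr Finv.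
exists [seq x * (y - trans T 0 0) | y <- bad] => h hbad.
have [|ps [psP psE]] := badP (h / x + trans T 0 0).
  apply: contraNN hbad => hb; apply/mapP; exists (h / x + trans T 0 0) => //.
  by rewrite addrK mulrCA mulfV // mulr1.
exists ps; split=> //; rewrite -psE; congr (_ `&` _).
rewrite predeqE => p /=; rewrite dotm; split=> [<-|->]; last by field.
by rewrite mulrAC mulfV // mul1r subrK.
Qed.
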